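(* Fix an integer $k>1$. Let $a_{\alpha_1,\dots,\alpha_{k+1}}\in\mathbb{C}$ be fixed constants, indexed by integers $\alpha_1\le\dots\le\alpha_{k+1}$ with $\alpha_1+\dots+\alpha_{k+1}=\frac{k(k+1)}{2}$, with $a_{0,1,\dots,k}=1$. For a parameter $q\in\mathbb C$ and $i\in\mathbb{Z}$ put $$z_i(q)=\sum_{\substack{\alpha_1\le\dots\le\alpha_{k+1}\in\mathbb{Z}\\ \alpha_1+\dots+\alpha_{k+1}=\frac{k(k+1)}{2}}} q^{\alpha_1^2+\dots+\alpha_{k+1}^2-1^2-2^2-\dots-k^2}\,a_{\alpha_1,\dots,\alpha_{k+1}}\,x_{i+\alpha_1}x_{i+\alpha_2}\cdots x_{i+\alpha_{k+1}},$$ and assume that the right-hand side can be written as $x_ix_{i+1}\cdots x_{i+k}+O(q)$ (i.e. every term with nonzero coefficient other than $x_ix_{i+1}\cdots x_{i+k}$ carries a strictly positive power of $q$). Let $B(q)$ be the quotient of the algebra $A$ by the ideal generated by $\{z_i(q),\ i\in\mathbb{Z}\}$, so that $B(0)$ is the quotient of $A$ by the ideal generated by the monomials $x_ix_{i+1}\cdots x_{i+k}$, $i\in\mathbb{Z}$. Then $B(q)$ is a flat deformation of $B(0)$ if and only if the elements $z_i(q)$ satisfy in $A$ $$x_iz_{i+1}(q)-x_{i+k+1}z_i(q)=\sum_{\beta\in\mathbb{Z}} g_{\beta}(q)\,x_{i-(k+1)\beta}\,z_{i+1+\beta}(q),\qquad i\in\mathbb{Z},$$ for some holomorphic functions $g_\beta(q)$,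 $\beta\in\mathbb{Z}$, of the parameter $q$ (independent of $i$) with $g_\beta(0)=0$.
   Context: Algebra $A$. Let $P=\mathbb{C}[x_i,\ i\in\mathbb{Z}]$, graded by $\mathbb{Z}^2$ with $\deg(x_i)=(i,1)$, so that $P_{n,l}$ is spanned by monomials $x_{i_1}^{a_1}\cdots x_{i_m}^{a_m}$ with $\sum a_ri_r=n$, $\sum a_r=l$. Let $A_{n,l}$ be the space of infinite formal sums (with complex coefficients) of monomials in $P_{n,l}$ and $A=\bigoplus_{n,l}A_{n,l}$; multiplication is well defined, and $A$ is a commutative associative $\mathbb{Z}^2$-graded algebra. Ideals. For homogeneous elements $g_i\in A$ ($i\in\mathbb{Z}$), the ideal generated by $\{g_i\}$ means the set of all infinite formal sums $\sum_i p_ig_i\in A$ with $p_i\in A$ (each such sum lying in a direct sum of finitely many homogeneous components $A_{n,l}$). Dimensions. Let $C_N\subset A$ be the ideal generated by $x_{N+1},x_{N+2},\dots$. For a graded quotient $Q$ of $A$, $\dim_N Q_{n,l}$ denotes the (finite) dimension of the $(n,l)$ graded component of $Q/C_N$, i.e. of the quotient of $Q$ by the image of $C_N$; statements with $\dim_N$ are always meant for $N\gg0$. Flatness. Let $I_q$ ($q$ a complex parameter) be the ideal generated by a family of homogeneous elements $m_\alpha(q)\in A$ such that $m_\alpha(0)$ are monomials. The deformation $A/I_q$ of $A/I_0$ is called flat if the dimensions of the graded components $(A/I_q)_{n,l}$ and $(A/I_0)_{n,l}$ are equal for all $n,l$, in the sense $\dim_N(A/I_q)_{n,l}=\dim_N(A/I_0)_{n,l}$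 for $N\gg0$. *)

(* Defs.v *)
From mathcomp Require Import all_boot all_order all_algebra finmap multiset.
From mathcomp Require Import complex.
From mathcomp Require Import all_classical all_reals all_analysis.

Set Implicit Arguments.
Unset Strict Implicit.
Unset Printing Implicit Defensive.

Import Order.TTheory GRing.Theory Num.Theory.
Import numFieldNormedType.Exports.

Local Open Scope classical_set_scope.
Local Open Scope ring_scope.

(* A monomial in the variables x_i (i : int) is the multiset of its indices. *)
Notation monom := {mset int}%mset.

Definition mdeg (m : monom) : int * int :=
  (\sum_(i <- m) i, (size m)%:Z).

(* Arbitrary formal sums of monomials, as coefficient functions; linear
   combinations are the pointwise ones.  The library's ring product on a
   function space is pointwise as well, hence NOT the product of formal sums,
   which is [fmul]. *)
Definition formal (K : fieldType) : lmodType K := (monom -> K^o).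

Section FormalSums.
Variable K : fieldType.
Implicit Types (f g : formal K) (m : monom) (d : int * int).

(* The sum ranges over the factorizations of [m], see [finite_factorizations]. *)
Definition fmul f g : formal K :=
  fun m => \sum_(p \in [set p : monom * monom | (p.1 `+` p.2)%mset = m])
    f p.1 * g p.2.

Definition fmonom m : formal K := fun m' => (m' == m)%:R.

Definition fvar (i : int) : formal K := fmonom [mset i]%mset.

(* [f] is the infinite formal sum of the [F t], [t] in [D]: every monomial
   occurs in finitely many summands, and coefficients are added. *)
Definition formal_sum_to (T : choiceType) (D : set T) (F : T -> formal K) f :=
  forall m, finite_set [set t | D t /\ F t m != 0] /\
            f m = \sum_(t \in D) F t m.

Definition A_comp d : set (formal K) :=
  [set f | forall m, f m != 0 -> mdeg m = d].

(* A is the direct sum of the A_comp d: only finitely many degrees occur. *)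
Definition A : set (formal K) :=
  [set f | finite_set (mdeg @` [set m | f m != 0])].

Definition ideal_gen (D : set int) (g : int -> formal K) : set (formal K) :=
  [set f | A f /\ exists p : int -> formal K,
     (forall i, D i -> A (p i)) /\
     formal_sum_to D (fun i => fmul (p i) (g i)) f].

Definition C_ (N : int) : set (formal K) := ideal_gen [set j | N < j] fvar.

Definition set_sum (I J : set (formal K)) : set (formal K) :=
  [set f | exists u v, [/\ I u, J v & f = u + v]].

(* The image of V in the quotient by W has dimension r: some r elements of V
   induce a basis of it. *)
Definition has_qdim (V W : set (formal K)) (r : nat) :=
  exists b : 'I_r -> formal K, (forall j, V (b j)) /\
    forall f, V f -> exists! c : 'rV[K]_r, W (f - \sum_j c 0 j *: b j).

(* dim_N (A/I)_d = r : as A/I modulo the image of C_N is A/(I + C_N), this is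
   the dimension of the image of A_d in A/(I + C_N). *)
Definition has_dimN (I : set (formal K)) (N : int) d (r : nat) :=
  has_qdim (A_comp d) (set_sum I (C_ N)) r.

Definition flat_deformation (I : K -> set (formal K)) :=
  forall (q : K) (d : int * int), exists N0 : int, forall N : int, N0 <= N ->
    exists r : nat, has_dimN (I q) N d r /\ has_dimN (I 0) N d r.

Section Relations.
Variable k : nat.

Definition index_set : set (k.+1.-tuple int) :=
  [set al | sorted <=%O al /\ \sum_(x <- al) x = (k * k.+1)./2%N%:Z].

Definition index0 : k.+1.-tuple int := [tuple (j : nat)%:Z | j < k.+1].

Definition qexp (al : k.+1.-tuple int) : int :=
  \sum_(x <- al) x ^+ 2 - \sum_(1 <= j < k.+1) j%:Z ^+ 2.

Definition shift_monom (i : int) (al : k.+1.-tuple int) : monom :=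
  seq_mset [seq i + x | x <- al].

(* Distinct [al] give distinct monomials, see [z_formal_sum]. *)
Definition z (a : k.+1.-tuple int -> K) (q : K) (i : int) : formal K :=
  fun m => \sum_(al \in index_set)
    (q ^ qexp al * a al) * fmonom (shift_monom i al) m.

Definition I_ (a : k.+1.-tuple int -> K) (q : K) : set (formal K) :=
  ideal_gen setT (z a q).

End Relations.
End FormalSums.

Definition holomorphic (R : realType) (f : R[i] -> R[i]) :=
  forall q : R[i], derivable (f : R[i]^o -> R[i]^o) q 1.

Lemma finite_factorizations (m : monom) :
  finite_set [set p : monom * monom | (p.1 `+` p.2)%mset = m].
Proof.
have finS : finite_set [set u : monom | (u `<=` m)%mset].
  apply: (@sub_finite_set _ _ [set seq_mset (mask (tval s) (m : seq int)) |
      s in [set: (size (m : seq int)).-tuple bool]]).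
    move=> u /= /msubsetP um.
    have [x|s /subseqP[b sb ->] us] := (count_subseqP u m).1.
      by rewrite !count_mem_mset.
    exists (tcast sb (in_tuple b)) => //=.
    rewrite val_tcast /= -[RHS]seq_mset_id.
    by apply/eq_seq_msetP; rewrite perm_sym.
  by apply: finite_image; exact: finite_finset.
apply: (@sub_finite_set _ _ ([set u : monom | (u `<=` m)%mset] `*`
  [set u : monom | (u `<=` m)%mset])); last exact: finite_setX.
move=> [u v] /= <-; split => /=; apply/msubsetP => x.
  by rewrite msetE2 leq_addr.
by rewrite msetE2 leq_addl.
Qed.

Lemma formalDE (K : fieldType) (f g : formal K) (m : monom) :
  (f + g) m = f m + g m.
Proof. by []. Qed.

Lemma formalBE (K : fieldType) (f g : formal K) (m : monom) :
  (f - g) m = f m - g m.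
Proof. by []. Qed.

Lemma formalZE (K : fieldType) (c : K) (f : formal K) (m : monom) :
  (c *: f) m = c * f m.
Proof. by []. Qed.

Lemma shift_monom_inj (k : nat) (i : int) :
  {in @index_set k &, injective (@shift_monom k i)}.
Proof.
move=> s t; rewrite !inE => -[s_sorted _] [t_sorted _] /eq_seq_msetP.
move=> /(perm_map_inj (addrI i)) st; apply: val_inj.
exact: (sorted_eq le_trans le_anti).
Qed.

Lemma z_formal_sum (K : fieldType) (k : nat) (a : k.+1.-tuple int -> K)
    (q : K) (i : int) :
  formal_sum_to (@index_set k)
    (fun al => (q ^ qexp al * a al) *: fmonom K (shift_monom i al)) (z a q i).
Proof.
move=> m; split=> //.
have [[s [Ds sm]]|nos] := pselect (exists s, @index_set k s /\ shift_monom i s = m).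
  apply: (@sub_finite_set _ _ [set s]) => // t [Dt].
  rewrite formalZE /fmonom; case: (eqVneq m) => [mt _|_]; last by rewrite /= mulr0 eqxx.
  by apply: (@shift_monom_inj k i); rewrite ?inE // sm mt.
rewrite (_ : [set _ | _] = set0) // -subset0 => t [Dt].
rewrite formalZE /fmonom; case: (eqVneq m) => [mt _|_]; last by rewrite /= mulr0 eqxx.
by apply: nos; exists t.
Qed.

Lemma index0E (k : nat) : index0 k = [seq j%:Z | j <- iota 0 k.+1] :> seq int.
Proof. by rewrite -val_enum_ord -map_comp. Qed.

Lemma index_set0 (k : nat) : @index_set k (index0 k).
Proof.
split; rewrite index0E.
  by rewrite sorted_map; apply: (sub_sorted (e := leq)) (iota_sorted _ _).
rewrite big_map -(eq_bigr _ (fun j _ => natz j)) -natr_sum natz.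
by rewrite -{1}[k.+1]subn0 -/(index_iota 0 k.+1) bin2_sum bin2 mulnC.
Qed.

Lemma qexp0 (k : nat) : qexp (index0 k) = 0.
Proof.
rewrite /qexp index0E big_map /= big_cons expr0n add0r.
by apply/eqP; rewrite subr_eq0 /index_iota subSS subn0.
Qed.

Lemma z_at0 (K : fieldType) (k : nat) (a : k.+1.-tuple int -> K) (i : int) :
  a (index0 k) = 1 ->
  (forall al, @index_set k al -> a al != 0 -> al != index0 k -> 0 < qexp al) ->
  z a 0 i = fmonom K (shift_monom i (index0 k)).
Proof.
move=> a1 apos; apply/funext => m; rewrite /z.
rewrite -(fsbig_widen [set index0 k]) ?fsbig_set1.
- by rewrite qexp0 expr0z a1 !mul1r.
- by move=> _ ->; exact: index_set0.
move=> t [Dt /eqP t0] /=.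
have [->|at0] := eqVneq (a t) 0; first by rewrite mulr0 mul0r.
by rewrite exp0rz gt_eqF ?apos // mul0r mul0r.
Qed.

(* Main.v *)
(** Order monomials of a fixed degree by weight, the sum of the squares of the
    indices.  The leading (lightest) monomial of [z_i] is the run
    [x_i ... x_(i+k)], and rescaling [x_j] by [q^(j^2)] carries [z_i(1)] to
    [z_i(q)] up to a scalar; so for [q <> 0] everything reduces to [q = 1], and
    [g_b(q)] must be a constant times [q^((k+1)(k+2)b(b+1))].

    Modulo [C_N] a graded component is finite dimensional, and the standard
    monomials, those divisible by no run, always span its image in [B(q)] and form
    a basis at [q = 0].  Flatness thus means that they stay independent.

    If the relation holds, it is the S-polynomial reduction of the only critical
    pairs (adjacent runs; disjoint ones commute, the others factor through adjacent
    ones).  Dually: a functional on standard monomials, extended by downward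
    recursion on the weight so as to kill one multiple of some [z_i] for each
    nonstandard monomial, kills all multiples.  Conversely, determine the [c_b] by
    triangular recursion so that the combination of the [x_(i-(k+1)b) z_(i+1+b)]
    contains no nonstandard monomial; it lies in the ideal, so by flatness it is
    zero. *)

Require Import Defs.
From mathcomp Require Import all_boot all_order all_algebra finmap multiset.
From mathcomp Require Import complex.
From mathcomp Require Import all_classical all_reals all_analysis.
From mathcomp Require Import zify ring.

Set Implicit Arguments.
Unset Strict Implicit.
Unset Printing Implicit Defensive.

Import Order.TTheory GRing.Theory Num.Theory.
Import numFieldNormedType.Exports.

Local Open Scope classical_set_scope.
Local Open Scope ring_scope.

(** * Monomials and runs of consecutive variables *)

Section Monomials.
Implicit Types (m S T : monom) (i j x : int).

Lemma perm_msetD S T : perm_eq (S `+` T)%mset (S ++ T).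
Proof.
by apply/allP => x _ /=; rewrite count_cat !count_mem_mset msetE2.
Qed.

Lemma big_msetD (V : nmodType) (F : int -> V) S T :
  \sum_(x <- (S `+` T)%mset) F x = \sum_(x <- S) F x + \sum_(x <- T) F x.
Proof. by rewrite (perm_big _ (perm_msetD S T)) big_cat. Qed.

Lemma big_mset1 (V : nmodType) (F : int -> V) x :
  \sum_(y <- [mset x]%mset) F y = F x.
Proof. by rewrite enum_msetn big_seq1. Qed.

Lemma size_msetD S T : size (S `+` T)%mset = (size S + size T)%N.
Proof. by rewrite (perm_size (perm_msetD S T)) size_cat. Qed.

Lemma mdegD S T : mdeg (S `+` T)%mset = mdeg S + mdeg T.
Proof. by rewrite /mdeg big_msetD size_msetD PoszD. Qed.

Definition wt S : int := \sum_(x <- S) x ^+ 2.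

Lemma wtD S T : wt (S `+` T)%mset = wt S + wt T.
Proof. exact: big_msetD. Qed.

Lemma wt1 x : wt [mset x]%mset = x ^+ 2.
Proof. exact: big_mset1. Qed.

Lemma wt_ge0 S : 0 <= wt S.
Proof. by apply: sumr_ge0 => x _; exact: sqr_ge0. Qed.

Lemma mdeg1 x : mdeg [mset x]%mset = (x, 1).
Proof. by rewrite /mdeg big_mset1 enum_msetn. Qed.

(** The truncation condition: these are the monomials that survive modulo [C_N]. *)
Definition bounded_by (N : int) S := all (fun x => x <= N) S.

Lemma bounded_byD N S T :
  bounded_by N (S `+` T)%mset = bounded_by N S && bounded_by N T.
Proof. by rewrite /bounded_by (perm_all _ (perm_msetD S T)) all_cat. Qed.

Lemma bounded_by1 N x : bounded_by N [mset x]%mset = (x <= N).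
Proof. by rewrite /bounded_by enum_msetn /= andbT. Qed.

Lemma bounded_by_exists S : exists N0 : int, forall N, N0 <= N -> bounded_by N S.
Proof.
exists (\sum_(x <- S) `|x|) => N SN; apply/allP => x xS.
apply: le_trans SN; rewrite (big_rem x) //=.
apply: le_trans (ler_norm _) _; rewrite lerDl.
by apply: sumr_ge0.
Qed.

(** The [z_i] are index shifts of one another, so translation reduces the relation for all [i] to
    the case [i = 0]. *)
Definition translate (s : int) S : monom := seq_mset [seq s + x | x <- S].

Lemma translate_seq_mset s (l : seq int) :
  translate s (seq_mset l) = seq_mset [seq s + x | x <- l].
Proof. by apply/eq_seq_msetP; apply: perm_map; exact: perm_eq_seq_mset. Qed.

Lemma translateD s S T :
  translate s (S `+` T)%mset = (translate s S `+` translate s T)%mset.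
Proof.
rewrite -[RHS]seq_mset_id; apply/eq_seq_msetP; rewrite perm_sym.
apply: perm_trans (perm_msetD _ _) _; rewrite perm_sym.
apply: perm_trans (perm_map _ (perm_msetD S T)) _; rewrite map_cat.
by apply: perm_cat; rewrite perm_sym; exact: perm_eq_seq_mset.
Qed.

Lemma translate1 s x : translate s [mset x]%mset = [mset s + x]%mset.
Proof.
rewrite -[RHS]seq_mset_id; apply/eq_seq_msetP.
by rewrite !enum_msetn.
Qed.

Lemma translateK s : cancel (translate s) (translate (- s)).
Proof.
move=> S; rewrite /translate -/(translate _ _) translate_seq_mset -map_comp.
rewrite (eq_map (g := id)) ?map_id ?seq_mset_id // => x /=.
by rewrite addKr.
Qed.

Lemma mem_translate s S x : (x \in translate s S) = (x - s \in S).
Proof.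
rewrite /translate (perm_mem (perm_eq_seq_mset _)); apply/mapP/idP => [[y yS ->]|xS].
  by rewrite addrC addKr.
by exists (x - s) => //; rewrite addrC subrK.
Qed.

End Monomials.

Section Runs.
Variable k : nat.
Implicit Types (m S T : monom) (i j x : int).

Definition run i : monom := shift_monom i (index0 k).

Lemma perm_run i : perm_eq (run i) [seq i + n%:Z | n <- iota 0 k.+1].
Proof.
apply: perm_trans (perm_eq_seq_mset _) _.
by rewrite index0E -map_comp.
Qed.

Lemma runE i x : run i x = (i <= x <= i + k%:Z) :> nat.
Proof.
rewrite -count_mem_mset (permP (perm_run i)) count_uniq_mem; last first.
  by rewrite map_inj_uniq ?iota_uniq // => y z; lia.
congr nat_of_bool; apply/mapP/idP => [[n]|xi].
  by rewrite mem_iota => jk ->; lia.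
by exists `|x - i|%N; [rewrite mem_iota|]; lia.
Qed.

Lemma mem_run i x : (x \in run i) = (i <= x <= i + k%:Z).
Proof. by rewrite -mset_gt0 runE; case: (_ && _). Qed.

Lemma size_run i : size (run i) = k.+1.
Proof. by rewrite (perm_size (perm_run i)) size_map size_iota. Qed.

Lemma big_run (V : nmodType) (F : int -> V) i :
  \sum_(x <- run i) F x = \sum_(j < k.+1) F (i + (j : nat)%:Z).
Proof.
by rewrite (perm_big _ (perm_run i)) big_map -(subn0 k.+1) -/(index_iota _ _) big_mkord.
Qed.

Lemma sum_ord_int : 2 * (\sum_(j < k.+1) (j : nat)%:Z) = k%:Z * k.+1%:Z.
Proof.
elim: k => [|n IH]; first by rewrite big_ord1 mul0r mulr0.
by rewrite big_ord_recr /= mulrDr IH; lia.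
Qed.

Lemma mdeg_run i : mdeg (run i) = (k.+1%:Z * i + \sum_(j < k.+1) (j : nat)%:Z, k.+1%:Z).
Proof.
rewrite /mdeg size_run big_run big_split /= sumr_const card_ord -mulr_natl.
by rewrite natz.
Qed.

Lemma wt_run i :
  wt (run i) = k.+1%:Z * i ^+ 2 + k%:Z * k.+1%:Z * i + \sum_(j < k.+1) (j : nat)%:Z ^+ 2.
Proof.
rewrite /wt big_run.
under eq_bigr do rewrite sqrrD.
rewrite !big_split /= sumr_const card_ord -mulr_natl natz -sum_ord_int.
rewrite -!mulr_sumr; ring.
Qed.

Lemma mdeg_var_run i b :
  mdeg [mset i - k.+1%:Z * b]%mset + mdeg (run (i + 1 + b)) =
  mdeg [mset i]%mset + mdeg (run (i + 1)).
Proof.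
rewrite !mdeg_run !mdeg1; congr (_, _) => /=; ring.
Qed.

(** The excess vanishes exactly for [b = 0] and [b = -1], the two products on the left of the
    relation; every other product has a strictly heavier leading monomial. *)
Lemma wt_var_run i b :
  wt ([mset i - k.+1%:Z * b] `+` run (i + 1 + b))%mset =
  wt ([mset i] `+` run (i + 1))%mset + k.+1%:Z * k.+2%:Z * (b * (b + 1)).
Proof. rewrite !wtD !wt1 !wt_run; lia. Qed.

End Runs.

(** * Coefficients of the elements [z_i(q)] *)

Section Coefficients.
Variables (K : fieldType) (k : nat) (a : k.+1.-tuple int -> K).
Implicit Types (q : K) (i s : int) (T : monom).

Lemma z_shift q i (al : k.+1.-tuple int) : index_set al ->
  z a q i (shift_monom i al) = q ^ qexp al * a al.
Proof.
move=> Dal; rewrite /z -(fsbig_widen [set al]) ?fsbig_set1.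
- by rewrite /fmonom eqxx mulr1.
- by move=> _ ->.
move=> t [Dt /eqP tal]; rewrite /= /fmonom; case: eqVneq; last by rewrite mulr0.
by move=> /shift_monom_inj e; case/eqP: tal; rewrite e ?inE.
Qed.

Lemma z_supp q i T : z a q i T != 0 ->
  exists2 al, index_set al & T = @shift_monom k i al.
Proof.
move=> zT; apply: contrapT => no; move: zT; rewrite /z fsbig1 ?eqxx // => al Dal.
rewrite /fmonom; case: eqVneq; last by rewrite mulr0.
by move=> e; case: no; exists al.
Qed.

Lemma mdeg_shift i (al : k.+1.-tuple int) : index_set al ->
  mdeg (shift_monom i al) = mdeg (run k i).
Proof.
have sumE (be : k.+1.-tuple int) : index_set be ->
    mdeg (shift_monom i be) = (k.+1%:Z * i + (k * k.+1)./2%N%:Z, k.+1%:Z).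
  move=> [_ sbe]; rewrite /mdeg /shift_monom (perm_size (perm_eq_seq_mset _)).
  rewrite size_map size_tuple (perm_big _ (perm_eq_seq_mset _)) big_map big_split /=.
  by rewrite sbe big_const_seq count_predT size_tuple iter_addr addr0 -mulr_natl natz.
by move=> Dal; rewrite !sumE //; exact: index_set0.
Qed.

Lemma wt_shift i (al : k.+1.-tuple int) : index_set al ->
  wt (shift_monom i al) = wt (run k i) + qexp al.
Proof.
have wtE (be : k.+1.-tuple int) : index_set be ->
    wt (shift_monom i be) = k.+1%:Z * i ^+ 2 + 2 * i * (k * k.+1)./2%N%:Z
      + \sum_(x <- be) x ^+ 2.
  move=> [_ sbe]; rewrite /wt /shift_monom (perm_big _ (perm_eq_seq_mset _)) big_map.
  under eq_bigr do rewrite sqrrD.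
  rewrite !big_split /= -sbe big_const_seq count_predT size_tuple iter_addr addr0.
  rewrite -!mulr_sumr -mulr_natl natz; ring.
move=> Dal; rewrite !wtE //; last exact: index_set0.
have /eqP := qexp0 k; rewrite /qexp subr_eq0 => /eqP ->.
by rewrite -[RHS]addrA; congr (_ + _); rewrite addrC subrK.
Qed.

Lemma z_mdeg q i T : z a q i T != 0 -> mdeg T = mdeg (run k i).
Proof. by move=> /z_supp[al Dal ->]; exact: mdeg_shift. Qed.

(** The exponent [qexp] is the excess of the weight over that of the run, so [q] enters a
    coefficient only through the weight of its monomial; this includes [q = 0]. *)
Lemma z_scale q i T : z a q i T = q ^ (wt T - wt (run k i)) * z a 1 i T.
Proof.
have [[al Dal ->]|no] := pselect (exists2 al, index_set al & T = @shift_monom k i al).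
  by rewrite !z_shift // wt_shift // addrC addKr exp1rz mul1r.
have z0 q' : z a q' i T = 0 by apply/eqP/negPn/negP => /z_supp.
by rewrite !z0 mulr0.
Qed.

Lemma z_translate q i s T : z a q (s + i) (translate s T) = z a q i T.
Proof.
have trE al : translate s (shift_monom i al) = @shift_monom k (s + i) al.
  rewrite /shift_monom translate_seq_mset -map_comp; congr seq_mset.
  by apply: eq_map => x /=; rewrite addrA.
have [[al Dal ->]|no] := pselect (exists2 al, index_set al & T = @shift_monom k i al).
  by rewrite trE !z_shift.
rewrite [RHS](_ : _ = 0); last by apply/eqP/negPn/negP => /z_supp.
apply/eqP/negPn/negP => /z_supp[al Dal e]; apply: no; exists al => //.
by rewrite -(translateK s T) e -trE translateK.
Qed.

Hypothesis a1 : a (index0 k) = 1.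
Hypothesis apos : forall al, index_set al -> a al != 0 -> al != index0 k -> 0 < qexp al.

Lemma z_run q i : z a q i (run k i) = 1.
Proof. by rewrite z_shift ?qexp0 ?expr0z ?mul1r //; exact: index_set0. Qed.

Lemma z_wt q i T : z a q i T != 0 -> T = run k i \/ wt (run k i) < wt T.
Proof.
move=> zT; have [al Dal Te] := z_supp zT; move: zT.
rewrite Te z_shift // mulf_eq0 negb_or => /andP[_ aal].
have [->|al0] := eqVneq al (index0 k); first by left.
by right; rewrite wt_shift // ltrDl apos.
Qed.

End Coefficients.

(** * Finite boxes of monomials and pairings *)

Lemma fsum_seq (V : nmodType) (T : choiceType) (D : set T) (F : T -> V) (r : seq T) :
  uniq r -> (forall t, t \in r -> D t) ->
  (forall t, D t -> t \notin r -> F t = 0) ->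
  \sum_(t \in D) F t = \sum_(t <- r) F t.
Proof.
move=> ur rD F0; rewrite (@fsbigE _ _ _ _ _ r) //.
rewrite big_seq_cond [RHS]big_seq; apply: eq_bigl => t.
by case tr: (t \in r) => //=; rewrite mem_set //; exact: rD.
Qed.

Lemma finite_int_range (lo N : int) : finite_set [set x : int | lo <= x <= N].
Proof.
apply: (@sub_finite_set _ _ ((fun n : nat => lo + n%:Z) @` `I_(`|N - lo|.+1))).
  by move=> x /= xlo; exists `|x - lo|%N => /=; lia.
by apply: finite_image; exact: finite_II.
Qed.

Lemma finite_bounded_monoms (lo N : int) (l : nat) :
  finite_set [set S : monom | (size S <= l)%N /\ forall x, x \in S -> lo <= x <= N].
Proof.
elim: l => [|l IH].
  apply: (@sub_finite_set _ _ [set mset0]) => // S /= [].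
  by rewrite leqn0 size_mset_eq0 => /eqP.
pose f := fun p : int * monom => (p.1 +` p.2)%mset.
apply: (@sub_finite_set _ _ ([set mset0] `|`
  f @` ([set x : int | lo <= x <= N] `*`
    [set S : monom | (size S <= l)%N /\ forall x, x \in S -> lo <= x <= N]))).
  move=> S /= [Sl Sx]; case: (mset_0Vmem S) => [->|[x xS]]; first by left.
  right; exists (x, (S `\ x)%mset); rewrite /f /= ?msetB1K //.
  split; first exact: Sx.
  split=> [|y]; last by rewrite in_msetB1 => /andP[_ /Sx].
  move: Sl; rewrite -{1}(msetB1K xS) size_msetD enum_msetn /=.
  by rewrite add1n ltnS.
rewrite finite_setU; split => //; apply: finite_image.
by apply: finite_setX => //; exact: finite_int_range.
Qed.

(** Closure under divisors: the coefficient of a product at a monomial of [Y] then involves only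
    coefficients at monomials of [Y]. *)
Definition factor_closed (Y : seq monom) :=
  forall S T : monom, (S `+` T)%mset \in Y -> (S \in Y) && (T \in Y).

Lemma finite_component (N : int) (d : int * int) :
  exists Y : seq monom, [/\ uniq Y, factor_closed Y &
    forall S, mdeg S = d -> bounded_by N S -> S \in Y].
Proof.
pose lo := d.1 - (d.2 - 1) * N.
have fY := finite_bounded_monoms lo N `|d.2|%N.
have memY (S : monom) : (S \in fset_set [set S : monom | (size S <= `|d.2|)%N /\
    forall x, x \in S -> lo <= x <= N]) =
    `[< (size S <= `|d.2|)%N /\ forall x, x \in S -> lo <= x <= N >].
  by rewrite in_fset_set // unfold_in.
exists (fset_set [set S : monom | (size S <= `|d.2|)%N /\
  forall x, x \in S -> lo <= x <= N]).
split.
- exact: fset_uniq.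
- move=> S T; rewrite !memY => /asboolP[]; rewrite size_msetD => l h.
  apply/andP; split; apply/asboolP; split.
  + exact: leq_trans (leq_addr _ _) l.
  + by move=> x xS; apply: h; rewrite in_msetD xS.
  + exact: leq_trans (leq_addl _ _) l.
  + by move=> x xS; apply: h; rewrite in_msetD xS orbT.
move=> S Sd bS; rewrite memY; apply/asboolP; split.
  by rewrite -Sd /mdeg /=.
move=> x xS; rewrite (allP bS _ xS) andbT /lo -Sd /mdeg /=.
rewrite -(msetB1K xS) big_msetD big_mset1 size_msetD enum_msetn /= add1n.
have : bounded_by N (S `\ x)%mset.
  by move: bS; rewrite -{1}(msetB1K xS) bounded_byD => /andP[].
rewrite /bounded_by; elim: (EnumMset.f _) => [|y s IH] /=; first by rewrite big_nil; lia.
by rewrite big_cons => /andP[yN /IH]; lia.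
Qed.

Section Pairing.
Variable K : fieldType.
Implicit Types (f g : formal K) (m S T : monom).

Lemma fmul_fvar j g S :
  fmul (fvar K j) g S = if j \in S then g (S `\ j)%mset else 0.
Proof.
rewrite /fmul; case: ifPn => jS.
  rewrite (@fsum_seq _ _ _ _ [:: ([mset j]%mset, (S `\ j)%mset)]) //.
  - by rewrite big_seq1 /fvar /fmonom eqxx mul1r.
  - by move=> t; rewrite inE => /eqP -> /=; rewrite msetB1K.
  move=> [m T] /= mT; rewrite /fvar /fmonom inE; case: (eqVneq m [mset j]%mset) => [mj|*]; last by rewrite mul0r.
  by move: mT; rewrite mj => <-; rewrite msetD1K eqxx.
apply: fsbig1 => -[m T] /= mT; rewrite /fvar /fmonom; case: eqVneq => [mj|*]; last by rewrite mul0r.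
by move: jS; rewrite -mT mj in_mset1D eqxx.
Qed.

Lemma fmul_fmonom m g S :
  fmul (fmonom K m) g S = if (m `<=` S)%mset then g (S `\` m)%mset else 0.
Proof.
rewrite /fmul; case: ifPn => mS.
  rewrite (@fsum_seq _ _ _ _ [:: (m, (S `\` m)%mset)]) //.
  - by rewrite big_seq1 /fmonom eqxx mul1r.
  - by move=> t; rewrite inE => /eqP -> /=; rewrite msetBDKC.
  move=> [m' T] /= mT; rewrite /fmonom inE; case: (eqVneq m' m) => [mj|*]; last by rewrite mul0r.
  by move: mT; rewrite mj => <-; rewrite msetDKB eqxx.
apply: fsbig1 => -[m' T] /= mT; rewrite /fmonom; case: eqVneq => [mj|*]; last by rewrite mul0r.
by case/msubsetP: mS => x; rewrite -mT mj msetE2 leq_addr.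
Qed.

Section Box.
Variable Y : seq monom.
Hypotheses (Yuniq : uniq Y) (Ycl : factor_closed Y).

Lemma fmul_box f g S : S \in Y ->
  fmul f g S = \sum_(m <- Y) \sum_(T <- Y) f m * g T * ((m `+` T)%mset == S)%:R.
Proof.
move=> SY; rewrite /fmul (@fsum_seq _ _ _ _
  [seq p <- [seq (m, T) | m <- Y, T <- Y] | (p.1 `+` p.2)%mset == S]).
- rewrite big_filter big_mkcond big_allpairs /=.
  apply: eq_bigr => m _; apply: eq_bigr => T _ /=.
  by case: eqP; rewrite ?mulr1 ?mulr0.
- by rewrite filter_uniq // allpairs_uniq // => -[? ?] [? ?].
- by move=> t; rewrite mem_filter => /andP[/eqP].
move=> [m T] /= mT; rewrite mem_filter /= mT eqxx /= => /negP[].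
have /andP[mY TY] : (m \in Y) && (T \in Y) by apply: Ycl; rewrite mT.
by apply/allpairsP; exists (m, T).
Qed.

Definition pairing (phi : monom -> K) f : K := \sum_(S <- Y) phi S * f S.

Lemma pairingD phi f g : pairing phi (f + g) = pairing phi f + pairing phi g.
Proof. by rewrite -big_split; apply: eq_bigr => S _; rewrite formalDE mulrDr. Qed.

Lemma pairingB phi f g : pairing phi (f - g) = pairing phi f - pairing phi g.
Proof. by rewrite -sumrB; apply: eq_bigr => S _; rewrite formalBE mulrBr. Qed.

(** Products that leave the box are annihilated by [phi], so the truncated double sum loses nothing.
    If the inner sums vanish for all [m], then [phi] kills every multiple of [g]. *)
Lemma pairing_fmul (phi : monom -> K) f g :
  (forall S, S \notin Y -> phi S = 0) ->
  pairing phi (fmul f g) =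
  \sum_(m <- Y) f m * \sum_(T <- Y) phi (m `+` T)%mset * g T.
Proof.
move=> phi0; rewrite /pairing.
transitivity (\sum_(S <- Y) \sum_(m <- Y) \sum_(T <- Y)
    phi S * (f m * g T * ((m `+` T)%mset == S)%:R)).
  rewrite [LHS]big_seq [RHS]big_seq; apply: eq_bigr => S SY; rewrite fmul_box // mulr_sumr.
  by apply: eq_bigr => m _; rewrite mulr_sumr.
rewrite exchange_big /=; apply: eq_bigr => m _.
rewrite exchange_big mulr_sumr /=; apply: eq_bigr => T _.
have [mTY|mTY] := boolP ((m `+` T)%mset \in Y).
  rewrite (bigD1_seq _ mTY) //= eqxx big1 => [|S]; first by rewrite addr0 mulr1; ring.
  by rewrite eq_sym => /negPf ->; rewrite !mulr0.
rewrite phi0 // mul0r mulr0 big_seq big1 // => S SY.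
by case: eqP SY => [<-|]; rewrite ?(negPf mTY) // !mulr0.
Qed.

(** Only finitely many summands have a nonzero coefficient somewhere on the finite box, so the
    pairing can be exchanged with the infinite sum. *)
Lemma pairing_formal_sum (J : choiceType) (D : set J) (F : J -> formal K)
    (phi : monom -> K) f :
  formal_sum_to D F f -> (forall i, D i -> pairing phi (F i) = 0) -> pairing phi f = 0.
Proof.
move=> fF F0.
pose B := \bigcup_(S in [set` Y]) [set t | D t /\ F t S != 0].
have fB : finite_set B.
  by apply: bigcup_finite => [|S _]; [exact: finite_seq | exact: (fF S).1].
transitivity (\sum_(S <- Y) \sum_(t <- fset_set B) phi S * F t S).
  rewrite /pairing [LHS]big_seq [RHS]big_seq; apply: eq_bigr => S SY.
  rewrite (fF S).2 -mulr_sumr; congr (_ * _); apply: fsum_seq.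
  - exact: fset_uniq.
  - by move=> t; rewrite in_fset_set // => /set_mem[S' _ []].
  move=> t Dt; rewrite in_fset_set // => tB; apply/eqP/negP => /negP FtS.
  by move/negP: tB; apply; apply: mem_set; exists S.
rewrite exchange_big big_seq big1 // => t.
by rewrite in_fset_set // => /set_mem[S' _ [Dt _]]; exact: F0.
Qed.

End Box.

End Pairing.

(** * Dual functionals *)

Section RunLemmas.
Variable k : nat.
Implicit Types (i j x : int) (u S T : monom).

(** Both sides are [x_i ... x_(i+k+1)], the least common multiple of two adjacent runs. *)
Lemma run_next i :
  ([mset i] `+` run k (i + 1))%mset = ([mset i + k.+1%:Z] `+` run k i)%mset.
Proof.
apply/msetP => x; rewrite !msetE2 !msetnE !runE.
by do 2 case: eqVneq => ?; do 2 case: (boolP (_ && _)) => ?; lia.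
Qed.

Lemma gap_gt0 (b : int) : b != 0 -> b != -1 -> 0 < k.+1%:Z * k.+2%:Z * (b * (b + 1)).
Proof.
move=> b0 bN1; rewrite pmulr_rgt0 //.
have [b_gt0|b_lt] : 0 < b \/ b < -1 by lia.
  by nia.
by nia.
Qed.

Lemma bounded_run N i : bounded_by N (run k i) = (i + k%:Z <= N).
Proof.
apply/allP/idP => [h|h x]; last by rewrite mem_run; lia.
by apply: h; rewrite mem_run; lia.
Qed.

(** Overlapping or touching runs leave no gap, so [j - 1] lies in the first one. Hence [run (j - 1)]
    divides [u] too, and one can walk from [j] to [i] through adjacent runs. *)
Lemma run_sub_between i j u : i < j -> j <= i + k.+1%:Z ->
  (run k i `<=` u)%mset -> (run k j `<=` u)%mset -> ([mset j - 1] `+` run k j `<=` u)%mset.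
Proof.
move=> ij jik /msubsetP iu /msubsetP ju; apply/msubsetP => x.
move: (iu x) (ju x); rewrite msetE2 msetnE !runE; move: (u x) => v.
by case: (eqVneq x) => ?; do 2 case: (boolP (_ && _)) => ?; lia.
Qed.

Lemma run_sub_coprime i j u : i + k.+1%:Z <= j ->
  (run k i `<=` u)%mset -> (run k j `<=` u)%mset -> (run k i `+` run k j `<=` u)%mset.
Proof.
move=> ij /msubsetP iu /msubsetP ju; apply/msubsetP => x.
rewrite msetE2; have := iu x; have := ju x; rewrite !runE.
by do 2 case: (boolP (_ && _)) => ?; lia.
Qed.

Definition std S := `[< forall i, ~~ (run k i `<=` S)%mset >].

(** A chosen run dividing a nonstandard [u]; for standard [u] the value [0] is a dummy. *)
Definition run_in u : int := xget 0 [set i | (run k i `<=` u)%mset].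

Lemma run_inP u : ~~ std u -> (run k (run_in u) `<=` u)%mset.
Proof.
move=> /asboolPn/existsNP[i /negP/negPn iu].
by apply: (@xgetPex _ 0 [set i | (run k i `<=` u)%mset]); exists i.
Qed.

End RunLemmas.

(** * Functionals killing the multiples of a family led by the runs *)

Section Straightening.
Variables (K : fieldType) (k : nat) (zc : int -> formal K).
Implicit Types (i j b : int) (m S T u : monom) (phi : monom -> K).
Local Notation run := (run k).
Local Notation std := (std k).
Local Notation run_in := (run_in k).

Hypothesis zdeg : forall i T, zc i T != 0 -> mdeg T = mdeg (run i).
Hypothesis zrun : forall i, zc i (run i) = 1.
Hypothesis zwt : forall i T, zc i T != 0 -> T = run i \/ wt (run i) < wt T.

Lemma zwt_le i T : zc i T != 0 -> wt (run i) <= wt T.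
Proof. by move=> /zwt[->//|/ltW]. Qed.

Section Dual.
Variables (N : int) (d : int * int) (Y : seq monom).
Hypotheses (Yuniq : uniq Y) (Ycl : factor_closed Y).
Hypothesis YX : forall S, mdeg S = d -> bounded_by N S -> S \in Y.

Definition in_comp S := (mdeg S == d) && bounded_by N S.

Lemma in_comp_mem S : in_comp S -> S \in Y.
Proof. by move=> /andP[/eqP]; exact: YX. Qed.

(** An upper bound for the weights in the box, so that [W - wt u] is a nonnegative measure for
    downward recursion on the weight. *)
Let W : int := \sum_(S <- Y) wt S.

Lemma wt_le_sum S : S \in Y -> wt S <= W.
Proof.
move=> SY; rewrite /W (big_rem S) //= lerDl; apply: sumr_ge0 => T _; exact: wt_ge0.
Qed.

(** The value of [phi] on the multiple of [zc i] by the monomial [m]. *)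
Definition contract phi i m : K := \sum_(T <- Y) phi (m `+` T)%mset * zc i T.

Lemma contract_split phi i m : run i \in Y ->
  contract phi i m = phi (m `+` run i)%mset +
    \sum_(T <- Y | T != run i) phi (m `+` T)%mset * zc i T.
Proof. by move=> iY; rewrite /contract (bigD1_seq _ iY) //= zrun mulr1. Qed.

Lemma in_comp_run u : in_comp u -> ~~ std u -> run (run_in u) \in Y.
Proof.
move=> /in_comp_mem uY /run_inP iu; move: uY; rewrite -{1}(msetBDK iu).
by move=> /Ycl /andP[].
Qed.

(** For each nonstandard [u] the single required equation contains [phi u] with coefficient [1] and
    otherwise only values at heavier monomials. It therefore defines [phi u], one weight at a time
    from the top; [n] counts the levels already settled. *)
Lemma dual_approx (s : monom) (n : nat) : exists phi,
  [/\ forall S, ~~ in_comp S -> phi S = 0,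
      forall S, std S -> in_comp S -> phi S = (S == s)%:R
    & forall u, in_comp u -> ~~ std u -> W - wt u < n%:Z ->
        contract phi (run_in u) (u `\` run (run_in u))%mset = 0].
Proof.
elim: n => [|n [phi [phi0 phis phic]]].
  exists (fun S => (in_comp S && (S == s))%:R); split.
  - by move=> S /negPf ->.
  - by move=> S _ ->.
  by move=> u /in_comp_mem/wt_le_sum; lia.
pose step u := \sum_(T <- Y | T != run (run_in u))
  phi ((u `\` run (run_in u)) `+` T)%mset * zc (run_in u) T.
exists (fun u => if [&& in_comp u, ~~ std u & W - wt u == n%:Z] then - step u else phi u).
split.
- by move=> S /negPf XS; rewrite XS /= phi0 // XS.
- by move=> S stdS XS; rewrite stdS andbF phis.
move=> u Xu stdu; rewrite -addn1 PoszD ltzD1 le_eqVlt => Wu.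
have iu := run_inP stdu; have iY := in_comp_run Xu stdu.
have uE := msetBDK iu; set i := run_in u in iu iY uE *; set m := (u `\` run i)%mset in uE *.
(* The other monomials of the multiple are heavier than [u], hence strictly above level [n] and
   untouched by the update. *)
have above T : zc i T != 0 -> T != run i -> (W - wt (m `+` T)%mset == n%:Z) = false.
  move=> /zwt[->|]; first by rewrite eqxx.
  by move: Wu => /orP[/eqP|]; rewrite -uE !wtD; lia.
have rest : \sum_(T <- Y | T != run i) (if [&& in_comp (m `+` T)%mset,
      ~~ std (m `+` T)%mset & W - wt (m `+` T)%mset == n%:Z]
    then - step (m `+` T)%mset else phi (m `+` T)%mset) * zc i T = step u.
  apply: eq_bigr => T Ti; have [->|zT] := eqVneq (zc i T) 0; first by rewrite !mulr0.
  by rewrite above // !andbF.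
rewrite contract_split // rest uE Xu stdu /=.
case: eqVneq Wu => [_ _|_ /= Wu]; first by rewrite addNr.
by have := phic _ Xu stdu Wu; rewrite -/i -/m contract_split // uE.
Qed.

Variable c : int -> K.
Hypotheses (c0 : c 0 = -1) (cN1 : c (-1) = 1).
Hypothesis rel : forall i S,
  \sum_(b \in [set: int]) c b * fmul (fvar K (i - k.+1%:Z * b)) (zc (i + 1 + b)) S = 0.

(* A monomial of [zc i] all of whose indices are [< i + k] would survive the
   truncation at [N = i + k - 1], although the leading one does not.  Multiplied by
   [x_(i-1)] it could only cancel against such monomials closer to the leading one. *)
Lemma not_bounded i T : zc i T != 0 -> ~~ bounded_by (i + k%:Z - 1) T.
Proof.
suff main (n : nat) : forall i T, wt T - wt (run i) < n%:Z -> zc i T != 0 ->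
    ~~ bounded_by (i + k%:Z - 1) T.
  by move=> zT; apply: (main `|wt T - wt (run i)|.+1) (zT); have := zwt_le zT; lia.
elim: n => [|n IH] {i T} i T.
  by move=> + zT; have := zwt_le zT; lia.
move=> wT zT; apply/negP => bT.
have := rel (i - 1) ([mset (i - 1)] `+` T)%mset.
rewrite (@fsum_seq _ _ _ _ [:: 0]) //; last first.
  move=> b _; rewrite inE => b0; rewrite fmul_fvar; case: ifPn => [xS|]; last by rewrite mulr0.
  set S := ([mset (i - 1)] `+` T)%mset in xS *.
  have bS : bounded_by (i + k%:Z - 1) S.
    by rewrite bounded_byD bounded_by1 bT andbT; lia.
  have := allP bS _ xS => /= xb.
  apply/eqP; rewrite mulf_eq0; apply/orP; right; apply/negP => /negP zb.
  (* The index [i - 1 - (k+1) b] is at most [i + k - 1], which excludes negative [b], in particular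
     the other light product [b = -1]. For [b > 0] the excess weight drops by [(k+1)(k+2) b (b+1)],
     so the induction hypothesis applies. *)
  have SE := msetB1K xS; have b_gt0 : 0 < b by nia.
  have /negP[] : ~~ bounded_by (i - 1 + 1 + b + k%:Z - 1) (S `\ (i - 1 - k.+1%:Z * b))%mset.
    apply: IH (zb); have w1 := wt_var_run k (i - 1) b; have w2 := congr1 wt SE.
    have bN1 : b != -1 by lia.
    move: w1 w2 (gap_gt0 k b0 bN1) wT; rewrite !wtD !wt1 subrK; set E := k.+1%:Z * _ * _; lia.
  move: bS; rewrite -{1}SE bounded_byD => /andP[_ /allP bS'].
  by apply/allP => x /bS' /=; lia.
rewrite big_seq1 mulr0 subr0 fmul_fvar in_mset1D eqxx /= msetD1K c0 subrK addr0.
by move/eqP; rewrite mulN1r oppr_eq0 (negPf zT).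
Qed.

Section Vanishing.
Variable phi : monom -> K.
Hypothesis phi0 : forall S, ~~ in_comp S -> phi S = 0.
Hypothesis phic : forall u, in_comp u -> ~~ std u ->
  contract phi (run_in u) (u `\` run (run_in u))%mset = 0.

(** Truncation is compatible with leading monomials: if [run i] has an index above [N], then by
    [not_bounded] so does every monomial of [zc i], and degrees agree throughout [zc i]. *)
Lemma contract_out i m : ~~ in_comp (m `+` run i)%mset -> contract phi i m = 0.
Proof.
move=> Xu; rewrite /contract big1 // => T _.
have [->|zT] := eqVneq (zc i T) 0; first by rewrite mulr0.
rewrite phi0 ?mul0r //; apply: contra Xu => /andP[].
rewrite /in_comp !mdegD (zdeg zT) => -> /=; rewrite !bounded_byD => /andP[-> bT] /=.
rewrite bounded_run; apply: contraT; rewrite -ltNge => Ni.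
case/negP: (not_bounded zT); apply/allP => x xT.
by have := allP bT _ xT => /=; lia.
Qed.

Section Level.
Variable u : monom.
Hypothesis Xu : in_comp u.
Hypothesis IH : forall i m, wt u < wt (m `+` run i)%mset -> contract phi i m = 0.

(** The critical pair of adjacent runs. In [y] times the relation, the products with [b] other than
    [0] and [-1] have leading monomials heavier than [u] and are killed by [IH]; the two remaining
    ones must cancel. *)
Lemma contract_next y i : u = (y `+` ([mset i] `+` run (i + 1)))%mset ->
  contract phi (i + 1) (y `+` [mset i])%mset = contract phi i (y `+` [mset i + k.+1%:Z])%mset.
Proof.
move=> uE.
(* A finite list containing every [b] whose variable [x_(i-(k+1)b)] divides a monomial of the box,
   together with the two distinguished values. *)
pose B := undup (flatten [seq [seq ((i - x) %/ k.+1%:Z)%Z | x <- (m : seq int)] | m <- Y] ++ [:: 0; -1]).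
have memB b (S : monom) : S \in Y -> i - k.+1%:Z * b \in S -> b \in B.
  move=> SY bS; rewrite mem_undup mem_cat; apply/orP; left; apply/flatten_mapP; exists S => //.
  apply/mapP; exists (i - k.+1%:Z * b) => //.
  by rewrite opprB addrC subrK mulrC mulzK.
have relB S : S \in Y ->
    \sum_(b <- B) c b * fmul (fvar K (i - k.+1%:Z * b)) (zc (i + 1 + b)) S = 0.
  move=> SY; have := rel i S; rewrite (@fsum_seq _ _ _ _ B) //; first exact: undup_uniq.
  move=> b _ bB; rewrite fmul_fvar; case: ifPn => [bS|]; last by rewrite mulr0.
  by case/negP: bB; exact: memB bS.
have phiY y' : forall S, S \notin Y -> phi (y' `+` S)%mset = 0.
  move=> S SY; apply: phi0; apply: contra SY => /in_comp_mem /Ycl /andP[] //.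
have contractE b : contract phi (i + 1 + b) (y `+` [mset i - k.+1%:Z * b])%mset =
    pairing Y (fun S => phi (y `+` S)%mset) (fmul (fvar K (i - k.+1%:Z * b)) (zc (i + 1 + b))).
  rewrite pairing_fmul // /contract; last exact: phiY.
  set x := i - _; have [xY|xY] := boolP ([mset x]%mset \in Y).
    have x1 : fvar K x [mset x]%mset = 1 by rewrite /fvar /fmonom eqxx.
    rewrite [RHS](bigD1_seq [mset x]%mset) //= x1 mul1r [X in _ = _ + X]big1 ?addr0.
      by apply: eq_bigr => T _; rewrite msetDA.
    by move=> m' /negPf mx; rewrite /fvar /fmonom mx mul0r.
  rewrite [RHS]big_seq [RHS]big1 => [|m' m'Y].
    rewrite big1 // => T _; rewrite phi0 ?mul0r //; apply: contra xY.
    by move=> /in_comp_mem /Ycl /andP[] /Ycl /andP[].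
  rewrite /fvar /fmonom; case: eqVneq m'Y => [->|_ _]; rewrite ?(negPf xY) //.
  by rewrite mul0r.
have : \sum_(b <- B) c b * contract phi (i + 1 + b) (y `+` [mset i - k.+1%:Z * b])%mset = 0.
  transitivity (\sum_(S <- Y) phi (y `+` S)%mset *
      \sum_(b <- B) c b * fmul (fvar K (i - k.+1%:Z * b)) (zc (i + 1 + b)) S).
    transitivity (\sum_(b <- B) \sum_(S <- Y) phi (y `+` S)%mset *
      (c b * fmul (fvar K (i - k.+1%:Z * b)) (zc (i + 1 + b)) S)).
      apply: eq_bigr => b _; rewrite contractE /pairing mulr_sumr.
      by apply: eq_bigr => S _; ring.
    by rewrite exchange_big /=; apply: eq_bigr => S _; rewrite mulr_sumr.
  by rewrite big_seq big1 // => S SY; rewrite relB // mulr0.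
have B0 : 0 \in B by rewrite mem_undup mem_cat !inE orbT.
have BN1 : -1 \in B by rewrite mem_undup mem_cat !inE !orbT.
rewrite (bigD1_seq 0) ?undup_uniq //= -big_filter (bigD1_seq (-1)) /=; last first.
- by rewrite filter_uniq // undup_uniq.
- by rewrite mem_filter BN1.
rewrite big_filter_cond big1 => [|b /andP[b0 bN1]]; last first.
  rewrite IH ?mulr0 // -msetDA uE !(wtD y) ltrD2l wt_var_run ltrDl.
  exact: gap_gt0.
rewrite c0 cN1 mulr0 subr0 !addr0 mul1r mulN1r mulrN1 opprK addrK.
by move=> /eqP; rewrite addrC subr_eq0 => /eqP.
Qed.

(** Both sides equal the value [Q] of [phi] on [y] times [zc i] times [zc j]: expanding either
    factor first, its terms other than the run raise the weight and are killed by [IH]. *)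
Lemma contract_coprime y i j : u = (y `+` (run i `+` run j))%mset ->
  contract phi i (y `+` run j)%mset = contract phi j (y `+` run i)%mset.
Proof.
move=> uE; have := in_comp_mem Xu; rewrite {1}uE => /Ycl/andP[_] /Ycl/andP[iY jY].
pose Q := \sum_(S <- Y) \sum_(T <- Y) phi (y `+` S `+` T)%mset * zc i S * zc j T.
transitivity Q.
  rewrite /Q exchange_big /= (bigD1_seq (run j)) //= [X in _ + X]big1 ?addr0.
    rewrite /contract; apply: eq_bigr => S _; rewrite zrun mulr1.
    by rewrite msetDAC.
  move=> T Tj; rewrite -mulr_suml; have [->|zT] := eqVneq (zc j T) 0; first by rewrite mulr0.
  have [Te|wT] := zwt zT; first by rewrite Te eqxx in Tj.
  have := @IH i (y `+` T)%mset; rewrite /contract.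
  under eq_bigr do rewrite msetDAC.
  by move=> ->; rewrite ?mul0r // uE !wtD; lia.
rewrite /Q (bigD1_seq (run i)) //= [X in _ + X]big1 ?addr0.
  by rewrite /contract; apply: eq_bigr => S _; rewrite zrun mulr1.
move=> S Si; have [zS|zS] := eqVneq (zc i S) 0.
  by rewrite big1 // => T _; rewrite zS mulr0 mul0r.
have [Se|wS] := zwt zS; first by rewrite Se eqxx in Si.
under eq_bigr do rewrite mulrAC.
rewrite -mulr_suml; have := @IH j (y `+` S)%mset; rewrite /contract => ->.
  by rewrite mul0r.
by rewrite uE !wtD; lia.
Qed.

(** Confluence: the equation attached to [u] does not depend on the run chosen in [u]. Distant runs
    are coprime; otherwise one moves from [j] to [j - 1] by an adjacent pair and inducts on the
    distance. *)
Lemma contract_indep i j : (run i `<=` u)%mset -> (run j `<=` u)%mset ->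
  contract phi i (u `\` run i)%mset = contract phi j (u `\` run j)%mset.
Proof.
wlog ij : i j / i <= j.
  move=> h iu ju; have [/h|/ltW/h] := leP i j; first exact.
  by move=> ->.
have [n -> {ij}] : exists n : nat, j = i + n%:Z by exists `|j - i|%N; lia.
move=> iu; elim: n => [|n IHn] ju; first by rewrite addr0.
set j' := i + _ in ju *; have [jk|jk] := leP j' (i + k.+1%:Z); last first.
  have [y uE] : exists y, u = (y `+` (run i `+` run j'))%mset.
    exists (u `\` (run i `+` run j'))%mset; apply/esym/msetBDK.
    by apply: run_sub_coprime => //; exact: ltW.
  have := contract_coprime uE.
  have -> : (y `+` run j' = u `\` run i)%mset by rewrite uE msetDCA msetDKB.
  by have -> : (y `+` run i = u `\` run j')%mset by rewrite uE msetDA msetDKBC.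
have j'E : j' = (i + n%:Z) + 1 by rewrite /j'; lia.
have [y uE] : exists y, u = (y `+` ([mset (i + n%:Z)] `+` run (i + n%:Z + 1)))%mset.
  exists (u `\` ([mset (i + n%:Z)] `+` run (i + n%:Z + 1)))%mset; apply/esym/msetBDK.
  rewrite -{1}[i + n%:Z](addrK 1) -j'E; apply: run_sub_between jk iu ju.
  by rewrite /j'; lia.
have -> : (u `\` run j' = y `+` [mset (i + n%:Z)])%mset by rewrite uE j'E msetDA msetDKBC.
rewrite j'E (contract_next uE) IHn.
  by congr contract; rewrite {1}uE run_next msetDA msetDKBC.
rewrite uE run_next; apply/msubsetP => x; rewrite !msetE2.
by rewrite addnA leq_addl.
Qed.

End Level.

(** Downward induction on the weight of the leading monomial [u]: by confluence the contraction
    equals the one along [run_in u], which vanishes by construction of [phi]. *)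
Lemma contract0 i m : contract phi i m = 0.
Proof.
suff main (n : nat) : forall i m, W - wt (m `+` run i)%mset < n%:Z -> contract phi i m = 0.
  by apply: (main `|W - wt (m `+` run i)%mset|.+1); lia.
elim: n => [|n IH] {i m} i m; have [Xu|/contract_out //] := boolP (in_comp (m `+` run i)%mset).
  by have := wt_le_sum (in_comp_mem Xu); lia.
move=> Wu; set u := (m `+` run i)%mset in Xu Wu.
have iu : (run i `<=` u)%mset by apply/msubsetP => x; rewrite msetE2 leq_addl.
have stdu : ~~ std u by apply/asboolPn => /(_ i); rewrite iu.
have := phic Xu stdu; rewrite -(@contract_indep u Xu _ i) ?run_inP // ?msetDKBC //.
by move=> i' m' wu; apply: IH; lia.
Qed.

End Vanishing.

(** The coordinate functional of [s] on the quotient, which will prove the standard monomials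
    independent. *)
Lemma dual_basis (s : monom) : exists phi,
  [/\ forall S, ~~ in_comp S -> phi S = 0,
      forall S, std S -> in_comp S -> phi S = (S == s)%:R
    & forall f, set_sum (ideal_gen [set: int] zc) (@C_ K N) f -> pairing Y phi f = 0].
Proof.
(* Weights are nonnegative, so this many levels exhaust the box. *)
have [phi [phi0 phis phic]] := dual_approx s `|W|.+1.
exists phi; split=> // f [v [w [[_ [p [_ vp]]] [_ [r [_ wr]]] ->]]].
have phiY S : S \notin Y -> phi S = 0.
  by move=> SY; apply: phi0; apply: contra SY; exact: in_comp_mem.
rewrite pairingD (pairing_formal_sum vp) ?(pairing_formal_sum wr) ?addr0 //.
  move=> j /= Nj; rewrite pairing_fmul // big1 // => m _.
  rewrite [X in _ * X]big1 ?mulr0 // => T _; rewrite /fvar /fmonom.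
  case: eqVneq => [->|_]; last by rewrite mulr0.
  rewrite phi0 ?mul0r // /in_comp bounded_byD bounded_by1 leNgt Nj /=.
  by rewrite !andbF.
move=> i _; rewrite pairing_fmul // big1 // => m _.
rewrite -/(contract phi i m) contract0 ?mulr0 // => u Xu stdu.
by apply: phic => //; have := wt_ge0 u; lia.
Qed.

End Dual.

End Straightening.

(** * Subspaces of formal sums *)

Section Subspaces.
Variable K : fieldType.
Implicit Types (f g : formal K) (m S T : monom) (W : set (formal K)).

Lemma formal_sumE (J : Type) (r : seq J) (P : pred J) (F : J -> formal K) S :
  (\sum_(t <- r | P t) F t) S = \sum_(t <- r | P t) F t S.
Proof. by elim/big_rec2: _ => // t x y _ <-. Qed.

Definition subspace W := W 0 /\ forall (c : K) f g, W f -> W g -> W (c *: f + g).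

Lemma subspaceD W f g : subspace W -> W f -> W g -> W (f + g).
Proof. by move=> [_ h] Wf Wg; rewrite -(scale1r f); exact: h. Qed.

Lemma subspaceZ W c f : subspace W -> W f -> W (c *: f).
Proof. by move=> [W0 h] Wf; rewrite -(addr0 (c *: f)); exact: h. Qed.

Lemma subspaceB W f g : subspace W -> W f -> W g -> W (f - g).
Proof. by move=> Ws Wf Wg; rewrite -scaleN1r; apply: subspaceD => //; exact: subspaceZ. Qed.

Lemma subspace_sum W (J : eqType) (r : seq J) (P : pred J) (F : J -> formal K) :
  subspace W -> (forall t, P t -> W (F t)) -> W (\sum_(t <- r | P t) F t).
Proof.
move=> Ws h; apply: (big_ind W) => //; first exact: Ws.1.
by move=> f g; exact: subspaceD.
Qed.

Lemma fmul_lin c f f' g : fmul (c *: f + f') g = c *: fmul f g + fmul f' g.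
Proof.
apply/funext => S; have fS := finite_factorizations S.
rewrite formalDE formalZE /fmul mulr_fsumr -fsbig_split //.
by apply: eq_fsbigr => p _; rewrite formalDE formalZE mulrDl mulrA.
Qed.

Lemma fmul0l g : fmul 0 g = 0.
Proof. by apply/funext => S; rewrite /fmul fsbig1 // => p _; rewrite mul0r. Qed.

Lemma A_comp_A d f : A_comp d f -> A f.
Proof. by move=> fd; apply: (@sub_finite_set _ _ [set d]) => // t [m /fd <-]. Qed.

Lemma subspace_A : subspace (@A K).
Proof.
split; first by apply: (@sub_finite_set _ _ set0) => // t [m]; rewrite /= eqxx.
move=> c f g Af Ag.
apply: (@sub_finite_set _ _ (mdeg @` [set m | f m != 0] `|` mdeg @` [set m | g m != 0])).
  move=> _ [m /= fgm <-]; have [gm|gm] := eqVneq (g m) 0; last by right; exists m.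
  left; exists m => //=; apply: contra fgm => /eqP fm.
  by rewrite formalDE formalZE gm fm mulr0 addr0.
by rewrite finite_setU.
Qed.

Lemma subspace_A_comp d : subspace (@A_comp K d).
Proof.
split=> [m|c f g fd gd m]; first by rewrite eqxx.
have [gm|gm _] := eqVneq (g m) 0; last exact: gd.
have [fm|fm _] := eqVneq (f m) 0; last exact: fd.
by rewrite formalDE formalZE gm fm mulr0 addr0 eqxx.
Qed.

Lemma subspace_ideal D (z : int -> formal K) : subspace (ideal_gen D z).
Proof.
split.
  split; first exact: subspace_A.1.
  exists (fun=> 0); split=> [i _|m]; first exact: subspace_A.1.
  split; last by rewrite fsbig1 // => i _; rewrite fmul0l.
  by apply: (@sub_finite_set _ _ set0) => // i [_]; rewrite fmul0l eqxx.
move=> c f g [Af [p [Ap fp]]] [Ag [r [Ar gr]]]; split; first exact: subspace_A.2.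
exists (fun i => c *: p i + r i); split=> [i Di|m].
  by apply: subspace_A.2; [exact: Ap | exact: Ar].
have [ffin fE] := fp m; have [gfin gE] := gr m.
have fgfin : finite_set ([set t | D t /\ fmul (p t) (z t) m != 0] `|`
    [set t | D t /\ fmul (r t) (z t) m != 0]) by rewrite finite_setU.
split.
  apply: sub_finite_set fgfin => t [Dt]; rewrite fmul_lin formalDE formalZE => h.
  have [r0|r0] := eqVneq (fmul (r t) (z t) m) 0; last by right.
  by left; split=> //; apply: contra h => /eqP ->; rewrite r0 mulr0 addr0.
have sE (F : int -> K) :
    (forall t, F t != 0 -> fmul (p t) (z t) m != 0 \/ fmul (r t) (z t) m != 0) ->
    \sum_(t \in D) F t = \sum_(t <- fset_set ([set t | D t /\ fmul (p t) (z t) m != 0] `|`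
    [set t | D t /\ fmul (r t) (z t) m != 0])) F t.
  move=> F0; apply: fsum_seq; first exact: fset_uniq.
    by move=> t; rewrite in_fset_set // => /set_mem[[]|[]].
  move=> t Dt; rewrite in_fset_set // => tB; apply/eqP/negP => /negP /F0 Ft.
  by move/negP: tB; apply; apply: mem_set; case: Ft => ?; [left|right].
rewrite formalDE formalZE fE gE !sE; first last.
- by move=> t; left.
- by move=> t; right.
- move=> t; rewrite fmul_lin formalDE formalZE => h.
  have [r0|r0] := eqVneq (fmul (r t) (z t) m) 0; last by right.
  by left; apply: contra h => /eqP ->; rewrite r0 mulr0 addr0.
rewrite mulr_sumr -big_split; apply: eq_bigr => t _.
by rewrite fmul_lin formalDE formalZE.
Qed.

Lemma subspace_set_sum I J : subspace I -> subspace J -> subspace (@set_sum K I J).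
Proof.
move=> sI sJ; split; first by exists 0, 0; split; rewrite ?addr0; [case: sI|case: sJ|].
move=> c f g [u [v [Iu Jv ->]]] [u' [v' [Iu' Jv' ->]]].
exists (c *: u + u'), (c *: v + v'); split; [exact: sI.2|exact: sJ.2|].
by rewrite scalerDr addrACA.
Qed.

Lemma ideal_mul (z : int -> formal K) i m : (exists d, A_comp d (z i)) ->
  ideal_gen [set: int] z (fmul (fmonom K m) (z i)).
Proof.
move=> [d zd].
have Am : A_comp (mdeg m) (fmonom K m).
  by move=> S; rewrite /fmonom; case: (eqVneq S m) => [->//|_]; rewrite eqxx.
split.
  apply: (@A_comp_A (mdeg m + d)) => S; rewrite fmul_fmonom; case: ifP => [mS|]; last by rewrite eqxx.
  by move=> /zd <-; rewrite -mdegD msetBDKC.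
pose p j : formal K := if j == i then fmonom K m else 0.
exists p; split=> [j _|S].
  rewrite /p; case: ifP => _; [exact: A_comp_A Am | exact: subspace_A.1].
have p0 j : j != i -> fmul (p j) (z j) S = 0.
  by move=> /negPf ji; rewrite /p ji fmul0l.
split.
  apply: (@sub_finite_set _ _ [set i]) => // j [_ h]; apply/eqP.
  by apply: contraR h => /p0 ->; rewrite eqxx.
rewrite (@fsum_seq _ _ _ _ [:: i]) ?big_seq1 /p ?eqxx // => j _.
by rewrite inE => /p0.
Qed.

Lemma fmul_fvarr j g S :
  fmul g (fvar K j) S = if j \in S then g (S `\ j)%mset else 0.
Proof.
rewrite /fmul; case: ifPn => jS.
  rewrite (@fsum_seq _ _ _ _ [:: ((S `\ j)%mset, [mset j]%mset)]) //.
  - by rewrite big_seq1 /fvar /fmonom eqxx mulr1.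
  - by move=> t; rewrite inE => /eqP -> /=; rewrite msetDC msetB1K.
  move=> [T m] /= mT; rewrite /fvar /fmonom inE; case: (eqVneq m [mset j]%mset) => [mj|*]; last by rewrite mulr0.
  by move: mT; rewrite mj msetDC => <-; rewrite msetD1K eqxx.
apply: fsbig1 => -[T m] /= mT; rewrite /fvar /fmonom; case: eqVneq => [mj|]; last by rewrite mulr0.
by move: jS; rewrite -mT mj msetDC in_mset1D eqxx.
Qed.

(** Every monomial of [f] has an index above [N]. Assigning it to one such index [top S] and
    dividing by that variable splits [f] into multiples of the [x_j] with [N < j], each monomial
    being used once. *)
Lemma C_unbounded N d f : A_comp d f -> (forall S, bounded_by N S -> f S = 0) -> (@C_ K N) f.
Proof.
move=> fd f0; split; first exact: A_comp_A fd.
pose top (S : monom) : int := head 0 [seq x <- S | N < x].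
have topP S : ~~ bounded_by N S -> top S \in S /\ N < top S.
  move=> bS; have : has (fun x => N < x) S.
    by rewrite -(eq_has (fun x => esym (ltNge N x))) has_predC.
  rewrite has_filter /top; case E : [seq x <- _ | _] => [//|x s] _ /=.
  have : x \in [seq x <- S | N < x] by rewrite E mem_head.
  by rewrite mem_filter => /andP[-> ->].
pose p j : formal K := fun m => if top (j +` m)%mset == j then f (j +` m)%mset else 0.
have pE j S : N < j -> fmul (p j) (fvar K j) S = if top S == j then f S else 0.
  move=> Nj; rewrite fmul_fvarr; case: ifPn => [jS|jS]; first by rewrite /p msetB1K.
  case: eqP => // tj; rewrite f0 //; apply: contraT => /topP[].
  by rewrite tj (negPf jS).
exists p; split=> [j Nj|S].
  apply: (@A_comp_A (d - (j, 1))) => m; rewrite /p; case: ifP => [_|]; last by rewrite eqxx.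
  by move=> /fd <-; rewrite mdegD mdeg1 addrAC subrr add0r.
split.
  apply: (@sub_finite_set _ _ [set top S]) => // j [/= Nj]; rewrite pE //.
  by case: (eqVneq (top S) j) => [->//|_]; rewrite eqxx.
have [bS|bS] := boolP (bounded_by N S).
  by rewrite f0 // fsbig1 // => j /= Nj; rewrite pE // f0 // if_same.
have [tS Nt] := topP S bS.
rewrite (@fsum_seq _ _ _ _ [:: top S]) ?big_seq1 ?pE ?eqxx //.
- by move=> j; rewrite inE => /eqP ->.
by move=> j /= Nj; rewrite inE pE // eq_sym => /negPf ->.
Qed.

(** [MX] writes the basis in the spanning family and [MY] the family in the basis. From
    [MX *m MY = 1] one gets [r <= s]; for [r = s] the one-sided inverse is two-sided, so the
    spanning family is independent. *)
Lemma qdim_span (V W : set (formal K)) r s (e : 'I_s -> formal K) :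
  subspace W -> has_qdim V W r -> V 0 -> (forall i, V (e i)) ->
  (forall f, V f -> exists c : 'rV[K]_s, W (f - \sum_i c 0 i *: e i)) ->
  (r <= s)%N /\
  (r = s -> forall c : 'rV[K]_s, W (\sum_i c 0 i *: e i) -> c = 0).
Proof.
move=> sW [b [Vb bP]] V0 Ve eP.
have /choice[X XP] : forall j, exists c : 'rV[K]_s, W (b j - \sum_i c 0 i *: e i).
  by move=> j; exact: eP.
have /choice[Y YP] : forall i, exists c : 'rV[K]_r, W (e i - \sum_j c 0 j *: b j).
  by move=> i; have [c [Wc _]] := bP _ (Ve i); exists c.
pose MX : 'M[K]_(r, s) := \matrix_(j, i) X j 0 i.
pose MY : 'M[K]_(s, r) := \matrix_(i, j) Y i 0 j.
have subst_e (c : 'rV[K]_s) :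
    W (\sum_i c 0 i *: e i - \sum_j (c *m MY) 0 j *: b j).
  have -> : \sum_j (c *m MY) 0 j *: b j = \sum_i c 0 i *: \sum_j Y i 0 j *: b j.
    transitivity (\sum_j \sum_i (c 0 i * Y i 0 j) *: b j).
      apply: eq_bigr => j _; rewrite -scaler_suml mxE; congr (_ *: _).
      by apply: eq_bigr => i _; rewrite mxE.
    rewrite exchange_big; apply: eq_bigr => i _; rewrite scaler_sumr.
    by apply: eq_bigr => j _; rewrite scalerA.
  rewrite -sumrB; apply: subspace_sum => // i _.
  by rewrite -scalerBr; exact: subspaceZ.
(* Row [j] of either side gives coordinates of [b j] in the basis [b], and these are unique. *)
have XY : MX *m MY = 1%:M.
  apply/row_matrixP => j; have [c [_ cU]] := bP _ (Vb j).
  rewrite -[LHS]cU; last first.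
    have := subspaceD sW (XP j) (subst_e (X j)).
    rewrite addrA subrK; congr (W (_ - _)); apply: eq_bigr => l _; congr (_ *: _).
    by rewrite !mxE; apply: eq_bigr => i _; rewrite !mxE.
  apply: cU; rewrite (bigD1 j) //= big1 ?addr0 => [|l lj].
    by rewrite !mxE eqxx scale1r subrr; exact: sW.1.
  by rewrite !mxE eq_sym (negPf lj) scale0r.
split=> [|rs c Wc]; first exact: mulmx1_min XY.
case: s / rs e Ve eP X XP Y YP MX MY subst_e XY c Wc => e Ve eP X XP Y YP MX MY subst_e XY c Wc.
have YX := mulmx1C XY.
suff cY : c *m MY = 0 by rewrite -[c]mulmx1 -YX mulmxA cY mul0mx.
have [c' [_ cU]] := bP _ V0; rewrite -[LHS]cU.
  apply: cU; rewrite big1 => [|j _]; last by rewrite mxE scale0r.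
  by rewrite subrr; exact: sW.1.
have := subspaceB sW (subst_e c) Wc.
by rewrite addrAC subrr.
Qed.

End Subspaces.

(** * The standard basis *)

Section StdBasis.
Variables (K : fieldType) (k : nat) (zc : int -> formal K).
Implicit Types (i b : int) (m S T u : monom) (f g : formal K).
Local Notation run := (run k).
Local Notation std := (std k).
Local Notation run_in := (run_in k).

Hypothesis zdeg : forall i T, zc i T != 0 -> mdeg T = mdeg (run i).
Hypothesis zrun : forall i, zc i (run i) = 1.
Hypothesis zwt : forall i T, zc i T != 0 -> T = run i \/ wt (run i) < wt T.

Variables (N : int) (d : int * int) (Y : seq monom).
Hypotheses (Yuniq : uniq Y) (YX : forall S, mdeg S = d -> bounded_by N S -> S \in Y).
Local Notation in_comp := (in_comp N d).

Let W : int := \sum_(S <- Y) wt S.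

Lemma zc_A_comp i : A_comp (mdeg (run i)) (zc i).
Proof. by move=> T; exact: zdeg. Qed.

(** Nonstandard monomials are cancelled in order of increasing weight. Those bounded by [N] have
    weight at most [W], so finitely many rounds suffice; unbounded monomials are left alone, as they
    vanish modulo [C_N]. *)
Lemma std_reduce f : A_comp d f -> exists g,
  [/\ A_comp d g, forall S, bounded_by N S -> g S != 0 -> std S
    & ideal_gen [set: int] zc (f - g)].
Proof.
have subI := subspace_ideal [set: int] zc.
suff main (n : nat) : forall f, A_comp d f ->
    (forall S, in_comp S -> ~~ std S -> f S != 0 -> W - wt S < n%:Z) -> exists g,
  [/\ A_comp d g, forall S, bounded_by N S -> g S != 0 -> std S
    & ideal_gen [set: int] zc (f - g)].
  move=> fd; apply: (main `|W|.+1) => // S _ _ _; have := wt_ge0 S; lia.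
elim: n => [|n IH] {}f fd fW.
  exists f; split=> //; last by rewrite subrr; exact: subI.1.
  move=> S bS fS; apply: contraT => stdS.
  have XS : in_comp S by rewrite /in_comp (fd _ fS) eqxx.
  by have := fW _ XS stdS fS; have := wt_le_sum (YX (fd _ fS) bS); rewrite -/W; lia.
pose P u := [&& in_comp u, ~~ std u & W - wt u == n%:Z].
pose h u := fmul (fmonom K (u `\` run (run_in u))%mset) (zc (run_in u)).
(* All nonstandard monomials of the lowest weight still allowed are removed at once; the multiples
   [h u] create only heavier new ones. *)
pose v : formal K := \sum_(u <- Y | P u) f u *: h u.
have hI u : ideal_gen [set: int] zc (h u).
  by apply: ideal_mul; exists (mdeg (run (run_in u))); exact: zc_A_comp.
have hd u : P u -> A_comp d (h u).
  move=> /and3P[/andP[/eqP <- _] stdu _] S; rewrite /h fmul_fmonom; case: ifP => [mS|]; last by rewrite eqxx.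
  move=> /zdeg e; rewrite -(msetBDKC mS) mdegD e -mdegD.
  by rewrite msetBDK // run_inP.
have hS u S : P u -> h u S != 0 -> S = u \/ W - wt S < n%:Z.
  move=> /and3P[_ stdu /eqP Wu]; rewrite /h fmul_fmonom; case: ifP => [mS|]; last by rewrite eqxx.
  have uE := msetBDK (run_inP stdu).
  move=> /zwt[e|lt]; [left | right]; rewrite -(msetBDKC mS); first by rewrite e uE.
  by move: Wu; rewrite -{1}uE !wtD; lia.
have hu u : P u -> h u u = 1.
  move=> /and3P[_ stdu _]; rewrite /h fmul_fmonom msubsetDl.
  by rewrite msetBBK ?run_inP // zrun.
have vd : A_comp d v.
  by apply: subspace_sum; [exact: subspace_A_comp | move=> u /hd; exact: (subspaceZ _ (subspace_A_comp K d))].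
have [g [gd gstd gI]] : exists g, [/\ A_comp d g,
    forall S, bounded_by N S -> g S != 0 -> std S
    & ideal_gen [set: int] zc (f - v - g)].
  apply: IH; first exact: subspaceB (subspace_A_comp K d) fd vd.
  move=> S XS stdS; apply: contraR; rewrite -leNgt => nW.
  have SY : S \in Y by move: XS => /andP[/eqP]; exact: YX.
  rewrite formalBE subr_eq0 /v formal_sumE.
  have [PS|PS] := boolP (P S).
    rewrite big_mkcond (bigD1_seq S) //= PS formalZE hu // mulr1 big1 ?addr0 //.
    move=> u uS; case: ifP => // Pu; have [hSu|hSu] := eqVneq (h u S) 0.
      by rewrite formalZE hSu mulr0.
    have [e|] := hS _ _ Pu hSu; first by rewrite e eqxx in uS.
    by lia.
  rewrite big1 => [|u Pu].
    apply: contraR PS => /(fW _ XS stdS) lt; rewrite /P XS stdS /=.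
    by apply/eqP; lia.
  have [hSu|hSu] := eqVneq (h u S) 0; first by rewrite formalZE hSu mulr0.
  have [e|] := hS _ _ Pu hSu; first by rewrite e Pu in PS.
  by lia.
exists g; split=> //; rewrite -(subrK v f) addrAC; apply: subspaceD => //.
by apply: subspace_sum => // u _; apply: subspaceZ.
Qed.

Definition std_monoms := [seq S <- Y | in_comp S && std S].

Definition std_vec (j : 'I_(size std_monoms)) : formal K :=
  fmonom K (tnth (in_tuple std_monoms) j).

Lemma std_monomsP j : let S := tnth (in_tuple std_monoms) j in in_comp S /\ std S.
Proof.
have := mem_tnth j (in_tuple std_monoms).
by rewrite mem_filter => /andP[/andP[]].
Qed.

Lemma mem_std_monoms S : (S \in std_monoms) = in_comp S && std S.
Proof.
rewrite mem_filter andb_idr // => /andP[/andP[/eqP]] Sd bS _.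
exact: YX.
Qed.

Lemma std_vec_A_comp j : A_comp d (std_vec j).
Proof.
have [/andP[/eqP jd _] _] := std_monomsP j.
by move=> S; rewrite /std_vec /fmonom; case: (eqVneq S) => [->//|_]; rewrite eqxx.
Qed.

Lemma std_combE (c : 'rV[K]_(size std_monoms)) j :
  (\sum_l c 0 l *: std_vec l) (tnth (in_tuple std_monoms) j) = c 0 j.
Proof.
rewrite formal_sumE (bigD1 j) //= formalZE /std_vec /fmonom eqxx mulr1 big1 ?addr0 // => l lj.
have uS : uniq (in_tuple std_monoms) by rewrite /= filter_uniq.
by rewrite formalZE (inj_eq (tuple_uniqP _ uS)) eq_sym (negPf lj) mulr0.
Qed.

Lemma std_comb_out (c : 'rV[K]_(size std_monoms)) S : S \notin std_monoms ->
  (\sum_l c 0 l *: std_vec l) S = 0.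
Proof.
move=> SX; rewrite formal_sumE big1 // => l _; rewrite formalZE /std_vec /fmonom.
case: eqVneq => [e|_]; last by rewrite mulr0.
by case/negP: SX; rewrite e; exact: mem_tnth.
Qed.

Lemma C_std g : A_comp d g -> (forall S, bounded_by N S -> g S != 0 -> std S) ->
  (@C_ K N) (g - \sum_l (\row_l g (tnth (in_tuple std_monoms) l)) 0 l *: std_vec l).
Proof.
move=> gd gstd; apply: (@C_unbounded _ _ d).
  apply: (subspaceB (subspace_A_comp K d) gd); apply: subspace_sum; first exact: subspace_A_comp.
  by move=> l _; apply: (subspaceZ _ (subspace_A_comp K d)); exact: std_vec_A_comp.
move=> S bS; rewrite formalBE; have [SX|SX] := boolP (S \in std_monoms).
  have [l ->] : exists l, S = tnth (in_tuple std_monoms) l by apply/tnthP.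
  by rewrite std_combE mxE subrr.
rewrite std_comb_out // subr0; apply/eqP; apply: contraR SX => gS.
by rewrite mem_std_monoms /in_comp (gd _ gS) eqxx bS gstd.
Qed.

Lemma std_span f : A_comp d f -> exists c : 'rV[K]_(size std_monoms),
  set_sum (ideal_gen [set: int] zc) (@C_ K N) (f - \sum_l c 0 l *: std_vec l).
Proof.
move=> /std_reduce[g [gd gstd gI]].
exists (\row_l g (tnth (in_tuple std_monoms) l)).
exists (f - g), (g - \sum_l (\row_l g (tnth (in_tuple std_monoms) l)) 0 l *: std_vec l).
by split; rewrite ?addrA ?subrK //; exact: C_std.
Qed.

Section Independence.
Hypothesis Ycl : factor_closed Y.
Variable c : int -> K.
Hypotheses (c0 : c 0 = -1) (cN1 : c (-1) = 1).
Hypothesis rel : forall i S,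
  \sum_(b \in [set: int]) c b * fmul (fvar K (i - k.+1%:Z * b)) (zc (i + 1 + b)) S = 0.

(** Spanning comes from reduction; uniqueness of coordinates holds because the dual functional of
    the [j]-th standard monomial kills the ideal and [C_N] and reads off the [j]-th coordinate. *)
Lemma std_dim : has_dimN (ideal_gen [set: int] zc) N d (size std_monoms).
Proof.
exists std_vec; split=> [j|f fd]; first exact: std_vec_A_comp.
have [e We] := std_span fd; exists e; split=> // e' We'.
have sW : subspace (set_sum (ideal_gen [set: int] zc) (@C_ K N)).
  by apply: subspace_set_sum; exact: subspace_ideal.
have := subspaceB sW We We'; rewrite opprB addrC addrA subrK => We''.
apply/rowP => j; set s := tnth (in_tuple std_monoms) j.
have [sX sstd] := std_monomsP j.
have [phi [phi0 phis phiW]] := dual_basis zdeg zrun zwt Yuniq Ycl YX c0 cN1 rel s.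
have pairE (x : 'rV[K]_(size std_monoms)) : pairing Y phi (\sum_l x 0 l *: std_vec l) = x 0 j.
  rewrite /pairing (bigD1_seq s) //=; last by have := mem_tnth j (in_tuple std_monoms); rewrite mem_filter => /andP[].
  rewrite std_combE phis // eqxx mul1r big1 ?addr0 // => S Ss.
  have [|SX] := boolP (S \in std_monoms); last by rewrite std_comb_out ?mulr0.
  by rewrite mem_std_monoms => /andP[XS stdS]; rewrite phis // (negPf Ss) mul0r.
have := phiW _ We''.
rewrite pairingB !pairE.
by move=> /eqP; rewrite subr_eq0 => /eqP ->.
Qed.

End Independence.
End StdBasis.

(** * The relation and its rescaling *)

Section Relation.
Variables (K : fieldType) (k : nat) (a : k.+1.-tuple int -> K).
Implicit Types (q : K) (i b : int) (S T : monom) (c : int -> K).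
Local Notation run := (run k).
Local Notation std := (std k).

Hypothesis a1 : a (index0 k) = 1.
Hypothesis apos : forall al, index_set al -> a al != 0 -> al != index0 k -> 0 < qexp al.

(** The products on the right of the relation; [b = 0] and [b = -1] give the two on the left. *)
Definition xz q i b : formal K := fmul (fvar K (i - k.+1%:Z * b)) (z a q (i + 1 + b)).

Definition lead i b : monom := ([mset i - k.+1%:Z * b] `+` run (i + 1 + b))%mset.

(** Both sides of the relation gathered into one sum, the left one being absorbed into the
    coefficients at [0] and [-1]. *)
Definition relation q c := forall i S, \sum_(b \in [set: int]) c b * xz q i b S = 0.

Lemma xz_lead q i b : xz q i b (lead i b) = 1.
Proof. by rewrite /xz fmul_fvar in_mset1D eqxx msetD1K z_run. Qed.

Lemma xz_supp q i b S : xz q i b S != 0 ->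
  mdeg S = mdeg (lead i 0) /\ (S = lead i b \/ wt (lead i b) < wt S).
Proof.
rewrite /xz fmul_fvar; case: ifP => [xS|]; last by rewrite eqxx.
move=> zS; rewrite -(msetB1K xS); split.
  rewrite /lead mdegD (z_mdeg zS) mdeg_var_run /lead mdegD mulr0 subr0 addr0 //.
by have [->|lt] := z_wt apos zS; [left|right; rewrite !wtD ltrD2l].
Qed.

Lemma wt_lead i b : wt (lead i b) = wt (lead i 0) + k.+1%:Z * k.+2%:Z * (b * (b + 1)).
Proof. by rewrite /lead wt_var_run mulr0 subr0 addr0. Qed.

Lemma leadN1 i : lead i (-1) = lead i 0.
Proof.
rewrite /lead mulr0 subr0 addr0 run_next.
by congr (([mset _] `+` run _)%mset); lia.
Qed.

Definition var_indices i S : seq int := undup [seq ((i - x) %/ k.+1%:Z)%Z | x <- S].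

Lemma mem_var_indices q i b S : xz q i b S != 0 -> b \in var_indices i S.
Proof.
rewrite /xz fmul_fvar; case: ifP => [bS _|]; last by rewrite eqxx.
rewrite mem_undup; apply/mapP; exists (i - k.+1%:Z * b) => //.
by rewrite opprB addrC subrK mulrC mulzK.
Qed.

Lemma xz_sum q i S (r : seq int) (F : int -> K) :
  uniq r -> (forall b, xz q i b S != 0 -> b \in r) ->
  \sum_(b \in [set: int]) F b * xz q i b S = \sum_(b <- r) F b * xz q i b S.
Proof.
move=> ur h; apply: fsum_seq => // b _; apply: contraNeq.
by rewrite mulf_eq0 negb_or => /andP[_]; exact: h.
Qed.

Lemma xz_sum_formal q i (F : int -> K) (f : formal K) :
  (forall S, f S = \sum_(b \in [set: int]) F b * xz q i b S) ->
  formal_sum_to [set: int] (fun b => F b *: xz q i b) f.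
Proof.
move=> fE S; split; last first.
  by rewrite fE; apply: eq_fsbigr => b _; rewrite formalZE.
apply: (@sub_finite_set _ _ [set` var_indices i S]); last exact: finite_seq.
move=> b [_]; rewrite formalZE mulf_eq0 negb_or => /andP[_].
exact: mem_var_indices.
Qed.

(* The normalisation [c 0 = -1], [c (-1) = 1] moves the left-hand side of the
   relation into the sum. *)
Lemma xz_sum_shift q i S (F : int -> K) :
  \sum_(b \in [set: int]) (F b - (b == 0)%:R + (b == -1)%:R) * xz q i b S =
  \sum_(b \in [set: int]) F b * xz q i b S - (xz q i 0 S - xz q i (-1) S).
Proof.
pose r := undup (var_indices i S ++ [:: 0; -1]).
have ur : uniq r by exact: undup_uniq.
have rP b : xz q i b S != 0 -> b \in r.
  by move=> /mem_var_indices h; rewrite mem_undup mem_cat h.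
have sumE b0 : b0 \in r -> \sum_(b <- r) (b == b0)%:R * xz q i b S = xz q i b0 S.
  move=> br; rewrite (bigD1_seq b0) //= eqxx mul1r big1 ?addr0 // => b /negPf ->.
  by rewrite mul0r.
rewrite !(@xz_sum q i S r) // -(sumE 0) ?mem_undup ?mem_cat ?inE ?orbT //.
rewrite -(sumE (-1)) ?mem_undup ?mem_cat ?inE ?orbT // -!sumrB.
by apply: eq_bigr => b _; ring.
Qed.

Lemma qexp_ge0 i T : z a 1 i T != 0 -> 0 <= wt T - wt (run i).
Proof. by move=> zT; rewrite subr_ge0 (zwt_le (@z_wt _ _ _ apos 1) zT). Qed.

Let gap b : int := k.+1%:Z * k.+2%:Z * (b * (b + 1)).

Lemma gap_ge0 b : 0 <= gap b.
Proof.
have [->|b0] := eqVneq b 0; first by rewrite /gap mul0r mulr0.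
have [->|b1] := eqVneq b (-1); first by rewrite /gap addNr !mulr0.
by rewrite ltW // gap_gt0.
Qed.

Lemma xz_scale q i b S :
  q ^ gap b * xz q i b S = q ^ (wt S - wt (lead i 0)) * xz 1 i b S.
Proof.
rewrite /xz !fmul_fvar; case: ifP => [xS|]; last by rewrite !mulr0.
rewrite z_scale; set T := (S `\ _)%mset; have [->|zT] := eqVneq (z a 1 (i + 1 + b) T) 0.
  by rewrite !mulr0.
rewrite mulrA; congr (_ * _).
have -> : wt S - wt (lead i 0) = gap b + (wt T - wt (run (i + 1 + b))).
  have wS : wt S = (i - k.+1%:Z * b) ^+ 2 + wt T by rewrite -{1}(msetB1K xS) wtD wt1.
  have wl : wt (lead i b) = (i - k.+1%:Z * b) ^+ 2 + wt (run (i + 1 + b)) by rewrite wtD wt1.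
  by have := wt_lead i b; rewrite wl wS -/(gap b); lia.
(* Both exponents are nonnegative, so the powers multiply correctly even at [q = 0]. *)
have := qexp_ge0 zT; have := gap_ge0 b.
case: (gap b) => // m _; case: (_ - _) => // n _.
by rewrite exprzD_nat.
Qed.

Lemma relation_scale q c : relation 1 c -> relation q (fun b => c b * q ^ gap b).
Proof.
move=> rc i S; transitivity (q ^ (wt S - wt (lead i 0)) *
    \sum_(b \in [set: int]) c b * xz 1 i b S); last by rewrite rc mulr0.
rewrite mulr_fsumr; apply: eq_fsbigr => b _; rewrite -mulrA xz_scale mulrCA //.
Qed.

Lemma relation_unscale q c : q != 0 -> relation q c -> relation 1 (fun b => c b / q ^ gap b).
Proof.
move=> q0 rc i S.
transitivity ((q ^ (wt S - wt (lead i 0)))^-1 *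
    \sum_(b \in [set: int]) c b * xz q i b S); last by rewrite rc mulr0.
rewrite mulr_fsumr; apply: eq_fsbigr => b _; apply: (mulfI (expfz_neq0 (wt S - wt (lead i 0)) q0)).
rewrite [RHS]mulrA divff ?expfz_neq0 // mul1r mulrCA -xz_scale.
by rewrite mulrA divfK // expfz_neq0.
Qed.

Lemma relation_at0 : relation 0 (fun b => - (b == 0)%:R + (b == -1)%:R).
Proof.
move=> i S.
transitivity (\sum_(b \in [set: int])
    (0 - (b == 0)%:R + (b == -1)%:R) * xz 0 i b S).
  by apply: eq_fsbigr => b _; rewrite sub0r.
rewrite (xz_sum_shift 0 i S (fun=> 0)) fsbig1 ?sub0r => [|b _]; last by rewrite mul0r.
have xzE b : xz 0 i b S = (S == lead i b)%:R.
  rewrite /xz z_at0 // fmul_fvar /lead; case: ifPn => xS.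
    rewrite /fmonom -/(run _) -{2}(msetB1K xS); congr (nat_of_bool _)%:R.
    by apply/eqP/eqP => [->//|/(congr1 (fun X => X `\ (i - k.+1%:Z * b)))%mset]; rewrite !msetD1K.
  by case: eqVneq xS => // ->; rewrite in_mset1D eqxx.
by rewrite !xzE leadN1 subrr oppr0.
Qed.

(** At every [q] the dimension is the number of standard monomials of the component, a count that
    does not involve [q]. *)
Lemma relation_flat :
  (forall q, exists c, [/\ c 0 = -1, c (-1) = 1 & relation q c]) ->
  flat_deformation (I_ a).
Proof.
move=> rel q d; exists 0 => N _; have [Y [uY Ycl YX]] := finite_component N d.
have dimE q' : has_dimN (I_ a q') N d (size (std_monoms k N d Y)).
  have [c [c0 cN1 rc]] := rel q'.
  exact: (std_dim (@z_mdeg _ _ a q') (z_run a1 q') (@z_wt _ _ _ apos q') uY YX Ycl c0 cN1 rc).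
by exists (size (std_monoms k N d Y)); split; exact: dimE.
Qed.

(** Compare coefficients at the common leading monomial of the products [0] and [-1]; all other
    products consist of strictly heavier monomials. *)
Lemma relation_opp q c : relation q c -> c (-1) = - c 0.
Proof.
move=> rc; have := rc 0 (lead 0 0).
rewrite (@xz_sum q 0 _ [:: 0; -1]) //; last first.
  move=> b /xz_supp[_ sb]; rewrite !inE; apply: contraT; rewrite negb_or => /andP[b0 b1].
  have := gap_gt0 k b0 b1; have := wt_lead 0 b.
  by case: sb => [<-|]; lia.
rewrite big_cons big_seq1 xz_lead mulr1 -leadN1 xz_lead mulr1 => /eqP.
by rewrite addr_eq0 => /eqP ->; rewrite opprK.
Qed.

Lemma relation_normalize q c : c 0 != 0 -> relation q c ->
  exists c', [/\ c' 0 = -1, c' (-1) = 1 & relation q c'].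
Proof.
move=> c0 rc; exists (fun b => - (c 0)^-1 * c b); split.
- by rewrite mulNr mulVf.
- by rewrite (relation_opp rc) mulrNN mulVf.
move=> i S; transitivity (- (c 0)^-1 * \sum_(b \in [set: int]) c b * xz q i b S).
  rewrite mulr_fsumr; by apply: eq_fsbigr => b _; rewrite mulrA.
by rewrite rc mulr0.
Qed.

Lemma fmul_translate q i x j S :
  fmul (fvar K (i + x)) (z a q (i + j)) (translate i S) = fmul (fvar K x) (z a q j) S.
Proof.
apply: (etrans (fmul_fvar _ _ _)); apply: (etrans _ (esym (fmul_fvar _ _ _))).
rewrite mem_translate (addrC i x) addrK; case: ifP => [xS|_]; last exact: erefl.
have -> : translate i S = ([mset (x + i)] `+` translate i (S `\ x))%mset.
  by rewrite -{1}(msetB1K xS) translateD translate1 (addrC i x).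
rewrite msetD1K; exact: z_translate.
Qed.

Lemma xz_translate q i b S : xz q i b (translate i S) = xz q 0 b S.
Proof.
have e1 : i - k.+1%:Z * b = i + (0 - k.+1%:Z * b) by rewrite add0r.
have e2 : i + 1 + b = i + (0 + 1 + b) by rewrite add0r addrA.
by rewrite /xz e1 e2; exact: fmul_translate.
Qed.

Lemma relation_translate q c :
  (forall S, \sum_(b \in [set: int]) c b * xz q 0 b S = 0) -> relation q c.
Proof.
move=> rc i S; rewrite -[S](translateK (- i)) opprK.
set S' := translate (- i) S.
transitivity (\sum_(b \in [set: int]) c b * xz q 0 b S'); last exact: rc.
by apply: eq_fsbigr => b _; apply: congr1; exact: xz_translate.
Qed.

End Relation.

(** * Flatness implies the relation *)

Section Triangular.
Variable K : fieldType.
Implicit Types (b : int) (n : nat).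

(* [b] and [-1 - b] have the same level, because [b * (b + 1)] is the excess weight. *)
Definition level b : nat := if 0 <= b then `|b|%N else `|(b + 1)%R|%N.

Definition below n : seq int := flatten [seq [:: j%:Z; -1 - j%:Z] | j <- iota 0 n].

Lemma level_nat (j : nat) : level j%:Z = j.
Proof. by []. Qed.

Lemma level_neg (j : nat) : level (-1 - j%:Z) = j.
Proof. by rewrite /level; case: (boolP (0 <= -1 - j%:Z)) => ?; lia. Qed.

Lemma mem_below n b : (b \in below n) = (level b < n)%N.
Proof.
apply/flatten_mapP/idP => [[j]|bn].
  by rewrite mem_iota !inE => jn /orP[]/eqP ->; rewrite ?level_nat ?level_neg.
exists (level b); first by rewrite mem_iota.
rewrite !inE /level; case: ifP => b0; apply/orP; [left|right]; apply/eqP; lia.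
Qed.

Lemma uniq_below n : uniq (below n).
Proof.
elim: n => // n IH; rewrite /below -addn1 iotaD map_cat flatten_cat cat_uniq IH /=.
rewrite add0n orbF !mem_below negb_or level_nat level_neg ltnn /= inE andbT.
by lia.
Qed.

Lemma level_lt b b' : b * (b + 1) < b' * (b' + 1) -> (level b < level b')%N.
Proof.
by rewrite /level => h; rewrite ltnNge; apply/negP; case: ifP => ?; case: ifP => ? le; nia.
Qed.

Lemma triangular_solution (M : int -> int -> K) (c0 : int -> K) :
  exists c : int -> K, (forall b, level b = 0 -> c b = c0 b) /\
    forall b, (0 < level b)%N -> c b + \sum_(b' <- below (level b)) c b' * M b b' = 0.
Proof.
(* [C n] is correct at all levels up to [n]; the solution evaluates each index at its own level. *)
pose C := fix C n : int -> K := if n is n'.+1 then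
  fun b => if level b == n then - \sum_(b' <- below n) C n' b' * M b b' else C n' b
  else c0.
have CE n b : (level b <= n)%N -> C n b = C (level b) b.
  elim: n => [|n IH]; first by rewrite leqn0 => /eqP ->.
  rewrite leq_eqVlt => /orP[/eqP -> //|]; rewrite ltnS => bn.
  by rewrite -IH //= ltn_eqF.
exists (fun b => C (level b) b); split=> [b -> //|b].
case lb : (level b) => [//|n] _ /=; rewrite lb eqxx addrC; apply/eqP; rewrite subr_eq0.
apply/eqP; rewrite big_seq [RHS]big_seq; apply: eq_bigr => b'.
by rewrite mem_below ltnS => /CE ->.
Qed.

End Triangular.

Local Opaque z fmul.

Section Necessity.
Variables (K : fieldType) (k : nat) (a : k.+1.-tuple int -> K).
Implicit Types (q : K) (i b : int) (S T : monom) (c : int -> K).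
Local Notation run := (run k).
Local Notation std := (std k).
Local Notation lead := (lead k).

Hypothesis k_gt0 : (0 < k)%N.
Hypothesis a1 : a (index0 k) = 1.
Hypothesis apos : forall al, index_set al -> a al != 0 -> al != index0 k -> 0 < qexp al.

(** Equal weights leave only [b' = -1 - b]. In that case, as [k > 0], the variable [x_(i-(k+1)b)] of
    [lead i b] does not occur in [lead i b']. *)
Lemma lead_inj i b b' : b * (b + 1) = b' * (b' + 1) -> b != 0 -> b != -1 ->
  lead i b = lead i b' -> b = b'.
Proof.
move=> bb b0 b1 e; apply/eqP/negPn/negP => nbb.
have {}bb : b' = - 1 - b.
  have /eqP : (b - b') * (b + b' + 1) = 0 by lia.
  by rewrite mulf_eq0 subr_eq0 (negPf nbb) /= => /eqP; lia.
have : i - k.+1%:Z * b \in lead i b' by rewrite -e in_mset1D eqxx.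
rewrite /lead in_mset1D mem_run bb; have [b_gt0|b_lt] : 0 < b \/ b < -1 by lia.
  by case/orP => [/eqP|]; nia.
by case/orP => [/eqP|]; nia.
Qed.

(** Such a monomial has [k + 2] factors, so a nonstandard one is a run times a single variable,
    whose index is forced by the degree. *)
Lemma not_std_lead i S : mdeg S = mdeg (lead i 0) -> ~~ std S -> exists b, S = lead i b.
Proof.
move=> Sd /run_inP; set j := run_in _ _ => /msetBDK SE; exists (j - 1 - i).
have := Sd; rewrite -{1}SE mdegD /lead mdegD mulr0 subr0 addr0 !mdeg_run mdeg1.
set m := (S `\` run j)%mset in SE *; rewrite /mdeg => -[sm sz].
move/addIn: sz => sz.
have [x mx] : exists x, m = [mset x]%mset.
  case: (mset_0Vmem m) => [m0|[x xm]]; first by rewrite m0 size_mset0 in sz.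
  exists x; rewrite -(msetB1K xm); suff -> : (m `\ x)%mset = mset0 by rewrite msetD0.
  apply/eqP; rewrite -size_mset_eq0; move: sz; rewrite -{1}(msetB1K xm) size_msetD enum_msetn /=.
  by move/eqP; rewrite add1n eqSS.
rewrite -SE mx; move: sm; rewrite mx big_mset1 => sm.
congr (([mset _] `+` run _)%mset); last by lia.
by lia.
Qed.

(** Triangularity of the system for the [c b]: a product contains no monomial lighter than its
    leading one, and [lead_inj] excludes a coincidence within one level. *)
Lemma xz_lead_below q i b b' : b != 0 -> b != -1 -> b' != b ->
  xz a q i b' (lead i b) != 0 -> b' \in below (level b).
Proof.
move=> b0 b1 bb /(xz_supp apos)[_ h]; rewrite mem_below; apply: level_lt.
have p_gt0 : 0 < k.+1%:Z * k.+2%:Z by [].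
rewrite -(ltr_pM2l p_gt0); case: h => [e|].
  have := congr1 wt e; rewrite (wt_lead k i b) (wt_lead k i b') => /addrI /(mulfI (lt0r_neq0 p_gt0)) bbE.
  by case/eqP: bb; apply/esym/(lead_inj bbE b0 b1 e).
by rewrite (wt_lead k i b) (wt_lead k i b') ltrD2l.
Qed.

(** The values at [0] and [-1] cancel in the leading monomial they share. Every further [lead i b]
    has coefficient [1] in its own product and otherwise occurs only at lower levels, so it
    determines [c b]. *)
Lemma exists_lead_free i : exists c, [/\ c 0 = -1, c (-1) = 1 &
  forall b, \sum_(b' \in [set: int]) c b' * xz a 1 i b' (lead i b) = 0].
Proof.
have [c [cinit crec]] := triangular_solution (fun b b' => xz a 1 i b' (lead i b))
  (fun b => - (b == 0)%:R + (b == -1)%:R).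
exists c; have c0 : c 0 = -1 by rewrite cinit //= addr0.
have cN1 : c (-1) = 1 by rewrite cinit //= oppr0 add0r.
have lead0 : \sum_(b' \in [set: int]) c b' * xz a 1 i b' (lead i 0) = 0.
  rewrite (@xz_sum _ _ _ 1 i _ [:: 0; -1]) //; last first.
    move=> b /(xz_supp apos)[_ sb]; rewrite !inE; apply: contraT; rewrite negb_or => /andP[b0 b1].
    have := gap_gt0 k b0 b1; have := wt_lead k i b.
    by case: sb => [<-|]; lia.
  by rewrite big_cons big_seq1 xz_lead // -leadN1 xz_lead // c0 cN1 !mulr1 addNr.
split=> // b; have [->//|b0] := eqVneq b 0; have [->|b1] := eqVneq b (-1).
  by rewrite leadN1.
rewrite (@xz_sum _ _ _ 1 i _ (b :: below (level b))) //.
- rewrite big_cons xz_lead // mulr1 crec //.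
  by rewrite /level; case: ifP; lia.
- by rewrite /= mem_below ltnn uniq_below.
move=> b' h; rewrite inE; have [//|bb] := eqVneq b' b.
exact: xz_lead_below h.
Qed.

Lemma rel_sum_in_ideal c i (h : formal K) :
  (forall S, h S = \sum_(b \in [set: int]) c b * xz a 1 i b S) -> A h -> I_ a 1 h.
Proof.
move=> hE Ah; split=> //.
(* The sum over [b] is reindexed by the generator [z_j], with [j = i + 1 + b]. *)
pose p j : formal K := c (j - 1 - i) *: fvar K (i - k.+1%:Z * (j - 1 - i)).
have pE j S : fmul (p j) (z a 1 j) S = c (j - 1 - i) * xz a 1 i (j - 1 - i) S.
  have := fmul_lin (c (j - 1 - i)) (fvar K (i - k.+1%:Z * (j - 1 - i))) 0 (z a 1 j).
  rewrite addr0 -/(p j) => ->.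
  have e : i + 1 + (j - 1 - i) = j by lia.
  by rewrite fmul0l addr0 formalZE /xz e.
exists p; split=> [j _|S].
  apply: (subspaceZ _ (subspace_A K)); apply: (@A_comp_A _ (i - k.+1%:Z * (j - 1 - i), 1)) => m.
  by rewrite /fvar /fmonom; case: (eqVneq m) => [-> _|_]; rewrite ?mdeg1 ?eqxx.
have supp j : fmul (p j) (z a 1 j) S != 0 ->
    j \in [seq b + 1 + i | b <- var_indices k i S].
  rewrite pE mulf_eq0 negb_or => /andP[_ /mem_var_indices h'].
  by apply/mapP; exists (j - 1 - i) => //; lia.
split; first by apply: sub_finite_set (finite_seq _) => j [_]; exact: supp.
rewrite (@fsum_seq _ _ _ _ [seq b + 1 + i | b <- var_indices k i S]) //; first last.
- by move=> j _; apply: contraNeq; exact: supp.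
- by rewrite map_inj_uniq ?undup_uniq // => x y; lia.
rewrite big_map hE (@xz_sum _ _ _ 1 i S (var_indices k i S)) ?undup_uniq; first last.
- by move=> b; exact: mem_var_indices.
- by [].
- apply: eq_bigr => b _; have e : b + 1 + i - 1 - i = b by lia.
  by rewrite pE e.
Qed.

(** The standard monomials span at [q = 1] and form a basis at [q = 0]. Equality of dimensions makes
    them independent at [q = 1], so a combination of them lying in the ideal is zero. *)
Lemma flat_std_independent d N Y r (h : formal K) :
  uniq Y -> factor_closed Y -> (forall S, mdeg S = d -> bounded_by N S -> S \in Y) ->
  has_dimN (I_ a 1) N d r -> has_dimN (I_ a 0) N d r ->
  A_comp d h -> (forall S, bounded_by N S -> h S != 0 -> std S) -> I_ a 1 h ->
  forall S, bounded_by N S -> h S = 0.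
Proof.
move=> uY Ycl YX dim1 dim0 hd hstd hI.
have sW q : subspace (set_sum (I_ a q) (@C_ K N)).
  by apply: subspace_set_sum; exact: subspace_ideal.
have spanE q f := @std_span _ _ _ (@z_mdeg _ _ a q) (z_run a1 q) (@z_wt _ _ _ apos q) N d Y uY YX f.
have vecA j : A_comp d (@std_vec K k N d Y j) by exact: std_vec_A_comp.
have A0 : A_comp d (0 : formal K) by exact: (subspace_A_comp K d).1.
have [rs indep] := qdim_span (sW 1) dim1 A0 vecA (spanE 1).
have sr : (size (std_monoms k N d Y) <= r)%N.
  have [b [Vb bP]] := dim0.
  have dimS := std_dim (@z_mdeg _ _ a 0) (z_run a1 0) (@z_wt _ _ _ apos 0) uY YX Ycl
    (c := fun b => - (b == 0)%:R + (b == -1)%:R).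
  have {}dimS : has_dimN (I_ a 0) N d (size (std_monoms k N d Y)).
    apply: dimS; rewrite /= ?addr0 ?oppr0 ?add0r //; exact: relation_at0.
  have [] // := qdim_span (sW 0) dimS A0 Vb.
  by move=> f /bP[c [Wc _]]; exists c.
have rE : r = size (std_monoms k N d Y) by apply/eqP; rewrite eqn_leq rs sr.
have hC := C_std uY YX hd hstd.
have hW : set_sum (I_ a 1) (@C_ K N) (\sum_l (\row_l h (tnth (in_tuple (std_monoms k N d Y)) l)) 0 l *: std_vec K l).
  exists h, (- (h - \sum_l (\row_l h (tnth (in_tuple (std_monoms k N d Y)) l)) 0 l *: std_vec K l)).
  split=> //; last by rewrite opprB addrC subrK.
  by rewrite -scaleN1r; apply: subspaceZ => //; exact: subspace_ideal.
have row0 := indep rE _ hW.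
move=> S bS; apply/eqP; apply: contraT => hS.
have : S \in std_monoms k N d Y.
  by rewrite (mem_std_monoms k YX) /in_comp (hd _ hS) eqxx bS hstd.
move=> /(@tnthP _ _ (in_tuple _))[l Sl]; case/eqP: hS.
by have := congr1 (fun M : 'rV[K]__ => M 0 l) row0; rewrite !mxE Sl.
Qed.

(** In this degree the nonstandard monomials are exactly leading monomials of the products, and the
    chosen combination avoids all of them; lying in the ideal, it vanishes in every large
    truncation. *)
Lemma flat_relation : flat_deformation (I_ a) ->
  exists c, [/\ c 0 = -1, c (-1) = 1 & relation a 1 c].
Proof.
move=> flat; have [c [c0 cN1 clead]] := exists_lead_free 0.
exists c; split=> //; apply: relation_translate.
have [h hE] : exists h : formal K, forall S, h S = \sum_(b \in [set: int]) c b * xz a 1 0 b S.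
  by exists (fun S => \sum_(b \in [set: int]) c b * xz a 1 0 b S).
have hd : A_comp (mdeg (lead 0 0)) h.
  move=> S; rewrite hE => hS; apply/eqP; move: hS; apply: contraNT => Sd.
  rewrite fsbig1 // => b _; apply/eqP; rewrite mulf_eq0; apply/orP; right.
  by apply: contraNT Sd => /(xz_supp apos)[-> _]; exact: eqxx.
have hI : I_ a 1 h by apply: (rel_sum_in_ideal hE); exact: A_comp_A hd.
have hstd S : h S != 0 -> std S.
  move=> hS; apply: contraT => nstd; have [b Sb] := not_std_lead (hd _ hS) nstd.
  by move: hS; rewrite hE Sb clead eqxx.
move=> S; rewrite -hE.
(* The truncation must be large enough both for flatness to apply and for [S] to survive it. *)
have [N0 N0P] := flat 1 (mdeg (lead 0 0)); have [N1 N1P] := bounded_by_exists S.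
have N0_le : N0 <= Num.max N0 N1 by rewrite le_max lexx.
have N1_le : N1 <= Num.max N0 N1 by rewrite le_max lexx orbT.
have [r [dim1 dim0]] := N0P _ N0_le.
have [Y [uY Ycl YX]] := finite_component (Num.max N0 N1) (mdeg (lead 0 0)).
apply: (flat_std_independent uY Ycl YX dim1 dim0 hd _ hI).
  by move=> T _; exact: hstd.
exact: N1P.
Qed.

End Necessity.

(** * Holomorphic coefficients and the equivalence *)

Lemma holomorphic_away (R : realType) (f : R[i] -> R[i]) (y : R[i]) :
  holomorphic f -> f 0 != y -> exists2 q, q != 0 & f q != y.
Proof.
move=> fh fy.
have fc : {for 0, continuous (f : R[i]^o -> R[i]^o)}.
  by apply: differentiable_continuous; apply/derivable1_diffP; exact: fh.
have y0 : 0 < `|f 0 - y| by rewrite normr_gt0 subr_eq0.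
have near0 : \forall q \near (0 : R[i]^o)^', `|f 0 - f q| < `|f 0 - y|.
  by apply: nbhs_dnbhs; move/cvgrPdist_lt: fc; exact.
have [q [fq q0]] := filter_ex (filterI near0 (nbhs_dnbhs_neq (0 : R[i]^o))).
by exists q => //; apply: contraTneq fq => ->; rewrite ltxx.
Qed.

Lemma holomorphic_monomial (R : realType) (c y : R[i]) n :
  holomorphic (fun q => c * q ^+ n + y).
Proof.
move=> q; apply: derivableD; last exact: derivable_cst.
by apply: derivableM; [exact: derivable_cst | exact: exprn_derivable].
Qed.

Theorem theorem4p2 (R : realType) (k : nat) (hk : (1 < k)%N)
  (a : k.+1.-tuple int -> R[i]) (ha0 : a (index0 k) = 1)
  (hapos : forall al : k.+1.-tuple int,
     index_set al -> a al != 0 -> al != index0 k -> 0 < qexp al) :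
  flat_deformation (I_ a) <->
  exists g : int -> R[i] -> R[i],
    [/\ forall b : int, holomorphic (g b),
        forall b : int, g b 0 = 0
      & forall (q : R[i]) (i : int),
          formal_sum_to [set: int]
            (fun b : int =>
               g b q *: fmul (fvar R[i] (i - k.+1%:Z * b)) (z a q (i + 1 + b)))
            (fmul (fvar R[i] i) (z a q (i + 1))
             - fmul (fvar R[i] (i + k.+1%:Z)) (z a q i))].
Proof.
have lhsE q i S : (fmul (fvar R[i] i) (z a q (i + 1))
    - fmul (fvar R[i] (i + k.+1%:Z)) (z a q i)) S = xz a q i 0 S - xz a q i (-1) S.
  have e : i + k.+1%:Z = i - k.+1%:Z * -1 by rewrite mulrN1 opprK.
  by rewrite formalBE /xz mulr0 subr0 addr0 addrK e.
split=> [flat|[g [gh g0 grel]]].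
  have [c [c0 cN1 rc]] := flat_relation (ltnW hk) ha0 hapos flat.
  pose gap (b : int) : int := k.+1%:Z * k.+2%:Z * (b * (b + 1)).
  have gapE b : gap b = `|gap b|%N by rewrite gez0_abs // gap_ge0.
  (* The Kronecker terms undo the normalisation [c 0 = -1], [c (-1) = 1], making both of these
     functions zero; for all other [b] the exponent is positive, whence the value [0] at [q = 0]. *)
  exists (fun b q => c b * q ^+ `|gap b|%N + ((b == 0)%:R - (b == -1)%:R)).
  split=> [b|b|q i].
  - exact: holomorphic_monomial.
  - have [->|b0] := eqVneq b 0; first by rewrite /gap mul0r mulr0 expr0 c0 mulr1 subr0 addNr.
    have [->|b1] := eqVneq b (-1).
      by rewrite /gap addNr !mulr0 expr0 cN1 mulr1 sub0r subrr.
    have gap0 : `|gap b|%N != 0 by rewrite absz_eq0 gt_eqF // gap_gt0.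
    by rewrite expr0n (negPf gap0) mulr0 subrr addr0.
  apply: xz_sum_formal => S; rewrite lhsE; apply/esym/eqP; rewrite -subr_eq0 -xz_sum_shift.
  apply/eqP; apply: etrans (relation_scale hapos q rc i S); apply: eq_fsbigr => b _.
  by apply: (congr1 (fun x => x * _)); rewrite -/(gap b) {2}gapE -exprnP; ring.
(* Rescaling to [1] requires [q != 0], and normalising requires the coefficient [g 0 q - 1] to be
   nonzero. As [g 0] vanishes at [0], continuity provides such a [q]. *)
have [q q0 gq] : exists2 q, q != 0 & g 0 q != 1.
  by apply: holomorphic_away; [exact: gh | rewrite g0 eq_sym oner_eq0].
have rq : relation a q (fun b => g b q - (b == 0)%:R + (b == -1)%:R).
  move=> i S; rewrite xz_sum_shift -lhsE; apply/eqP; rewrite subr_eq0; apply/eqP.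
  rewrite (grel q i S).2; apply: eq_fsbigr => b _; exact: formalZE.
have [|c [c0 cN1 rc]] := relation_normalize ha0 hapos _ rq.
  by rewrite /= addr0 subr_eq0.
(* The relation at this single [q] gives one at [1], and rescaling carries that to every [q'],
   including [0]. *)
have r1 := relation_unscale hapos q0 rc.
apply: relation_flat => // q'; eexists; split; last exact: relation_scale r1.
- by rewrite /= c0 mul0r mulr0 !expr0z divr1 mulr1.
- by rewrite /= cN1 addNr !mulr0 !expr0z divr1 mulr1.
Qed.
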